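(* With probability tending to 1 as $n\to\infty$, $C^2(G_{n,1/2})=4$.
   Context: $G_{n,1/2}$ is the random graph on $n$ vertices with each pair adjacent independently with probability $1/2$. Counting logic for graphs: first-order formulas with variables over vertices, relations $\sim$ (adjacency) and $=$, Boolean connectives, quantifiers $\exists,\forall$, and counting quantifiers $\exists^m x\,\Psi$ (''at least $m$ vertices $x$ satisfy $\Psi$''), each contributing 1 to quantifier depth. A sentence defines $G$ if it is true on $G$ and false on every graph not isomorphic to $G$. $C^2(G)$ is the minimum quantifier depth of a counting-logic sentence with at most 2 distinct variable symbols (variables may be reused) defining $G$ ($\infty$ if none). *)

(* Defs.v *)
From HB Require Import structures.
From mathcomp Require Import all_boot all_order all_algebra.
From mathcomp Require Import all_classical all_reals all_analysis.

Set Implicit Arguments.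
Unset Strict Implicit.
Unset Printing Implicit Defensive.

Import Order.TTheory GRing.Theory Num.Theory.
Local Open Scope ring_scope.

Record sgraph := SGraph {
  vertex :> finType;
  adj : rel vertex;
  adj_sym : symmetric adj;
  adj_irrefl : irreflexive adj }.

Definition isomorphic (G H : sgraph) : Prop :=
  exists2 f : G -> H, bijective f & forall u v, adj (f u) (f v) = adj u v.

(* Variable symbols are natural numbers. *)
Inductive formula : Type :=
  | FAdj of nat & nat
  | FEq of nat & nat
  | FNot of formula
  | FAnd of formula & formula
  | FOr of formula & formula
  | FImp of formula & formula
  | FIff of formula & formula
  | FExists of nat & formula
  | FForall of nat & formula
  | FAtLeast of nat & nat & formula. (* FAtLeast m x a: at least m vertices x satisfy a *)

Fixpoint qdepth (f : formula) : nat :=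
  match f with
  | FAdj _ _ | FEq _ _ => 0%N
  | FNot a => qdepth a
  | FAnd a b | FOr a b | FImp a b | FIff a b => maxn (qdepth a) (qdepth b)
  | FExists _ a | FForall _ a | FAtLeast _ _ a => (qdepth a).+1
  end.

Fixpoint vars (f : formula) : seq nat :=
  match f with
  | FAdj x y | FEq x y => [:: x; y]
  | FNot a => vars a
  | FAnd a b | FOr a b | FImp a b | FIff a b => vars a ++ vars b
  | FExists x a | FForall x a | FAtLeast _ x a => x :: vars a
  end.

Definition width (f : formula) : nat := size (undup (vars f)).

Fixpoint free_vars (f : formula) : seq nat :=
  match f with
  | FAdj x y | FEq x y => [:: x; y]
  | FNot a => free_vars a
  | FAnd a b | FOr a b | FImp a b | FIff a b => free_vars a ++ free_vars b
  | FExists x a | FForall x a | FAtLeast _ x a =>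
      [seq y <- free_vars a | y != x]
  end.

Definition sentence (f : formula) : Prop := free_vars f = [::].

(* Assignments are partial so that sentences can also be evaluated on the graph
   without vertices. An atom with an unassigned variable is false; this never
   happens when a sentence is evaluated from the empty assignment. *)
Definition assignment (G : sgraph) := nat -> option G.

Definition assign (G : sgraph) (e : assignment G) (x : nat) (v : G) :
  assignment G := fun y => if y == x then Some v else e y.

Fixpoint eval (G : sgraph) (e : assignment G) (f : formula) : bool :=
  match f with
  | FAdj x y => if (e x, e y) is (Some u, Some v) then adj u v else false
  | FEq x y => if (e x, e y) is (Some u, Some v) then u == v else false
  | FNot a => ~~ eval e a
  | FAnd a b => eval e a && eval e b
  | FOr a b => eval e a || eval e b
  | FImp a b => eval e a ==> eval e b
  | FIff a b => eval e a == eval e b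
  | FExists x a => [exists v, eval (assign e x v) a]
  | FForall x a => [forall v, eval (assign e x v) a]
  | FAtLeast m x a => (m <= #|[pred v | eval (assign e x v) a]|)%N
  end.

Definition holds (G : sgraph) (f : formula) : bool :=
  eval (fun=> None : option G) f.

Definition defines (f : formula) (G : sgraph) : Prop :=
  holds G f /\ forall H : sgraph, ~ isomorphic G H -> ~ holds H f.

Definition definable_at (k d : nat) (G : sgraph) : Prop :=
  exists f, [/\ sentence f, (width f <= k)%N, qdepth f = d & defines f G].

(* The value of C^k(G); None stands for infinity. *)
Definition counting_depth (k : nat) (G : sgraph) : option nat :=
  if pselect (exists d, `[< definable_at k d G >]) is left h
  then Some (ex_minn h) else None.

Definition vpair (n : nat) : finType := {e : {set 'I_n} | #|e| == 2%N}.

(* A point of the sample space tells for each pair whether it is an edge. *)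
Definition sample (n : nat) : finType := {ffun vpair n -> bool}.

Definition sample_adj (n : nat) (w : sample n) : rel 'I_n :=
  fun u v => [exists e : vpair n, (val e == [set u; v]%SET) && w e].

Lemma sample_adj_sym (n : nat) (w : sample n) : symmetric (sample_adj w).
Proof. by move=> u v; rewrite /sample_adj finset.setUC. Qed.

Lemma sample_adj_irrefl (n : nat) (w : sample n) : irreflexive (sample_adj w).
Proof.
move=> u; apply/existsP => -[e /andP[/eqP eu _]].
by have := valP e; rewrite eu finset.setUid cards1.
Qed.

Definition sample_graph (n : nat) (w : sample n) : sgraph :=
  SGraph (sample_adj_sym w) (sample_adj_irrefl w).

(* The probability that G_{n,p} has property A. *)
Definition gnp_prob (R : realType) (n : nat) (p : R) (A : sgraph -> Prop) : R :=
  \sum_(w : sample n | `[< A (sample_graph w) >])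
    \prod_(e : vpair n) (if w e then p else 1 - p).

(* Main.v *)
Require Import Defs.
From HB Require Import structures.
From mathcomp Require Import all_boot all_order all_algebra all_fingroup.
From mathcomp Require Import zify ring lra.
From mathcomp Require Import all_classical all_reals all_analysis.

Set Implicit Arguments.
Unset Strict Implicit.
Unset Printing Implicit Defensive.

Import Order.TTheory GRing.Theory Num.Theory.
Import numFieldNormedType.Exports.
Import Defs.
Local Open Scope ring_scope.

(** Call the colour of a vertex the function counting its neighbours of each
degree. Two events of probability tending to 1 suffice.

(1) All colours are distinct. Then depth 2 identifies each vertex, and two more
quantifiers describe all adjacencies, so depth 4 is enough. To separate u and v,
take c0 adjacent to both or to neither, and let A be the neighbours of u which
are not neighbours of v. Ignoring c0, the degrees in A take more than 4 log n
values, by anticoncentration of binomial variables. Choose one vertex of A for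
each value: the edges from the chosen vertices to c0 are independent bits, and
at most one choice of these bits gives u and v the same colour.

(2) There are vertices a, b, c, d with deg a = deg d, deg b = deg c, with edges
ab, dc and non-edges ac, db. Switching these four pairs preserves all degrees
and colours, and a depth-3 sentence only sees the multiset of colours; by (1)
the new graph is not isomorphic to the old one, so depth 3 is not enough. Such
vertices exist because degrees avoid small values, so many disjoint pairs have
equal degrees, and any two fixed disjoint pairs form this pattern with
probability 1/16, independently in a grid of pairs. *)

(** * Depth 4 suffices *)

Section Logic.
Local Open Scope nat_scope.

Definition deg (G : sgraph) (x : G) : nat := #|[pred y | adj x y]|.

Definition nbr_deg (G : sgraph) (x : G) (d : nat) : nat :=
  #|[pred y | adj x y & deg y == d]|.

(** Equality of colours. Testing [d <= #|G|] is enough because every degree is below [#|G|]. *)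
Definition same_nbr_deg (G : sgraph) (x y : G) : bool :=
  [forall d : 'I_#|G|.+1, nbr_deg x d == nbr_deg y d].

Definition nbr_deg_separates (G : sgraph) : Prop :=
  forall x y : G, same_nbr_deg x y -> x = y.

(** A closed tautology, true on the empty graph as well. It costs one quantifier, which is why the
    lemmas on finite conjunctions and disjunctions ask for [0 < d]. *)
Definition FTrue : formula := FForall 0 (FEq 0 0).

Definition FAll (s : seq formula) : formula := foldr FAnd FTrue s.

Definition FAny (s : seq formula) : formula := foldr FOr (FNot FTrue) s.

Definition FExactly (m x : nat) (a : formula) : formula :=
  FAnd (FAtLeast m x a) (FNot (FAtLeast m.+1 x a)).

Lemma eval_FTrue (G : sgraph) (e : assignment G) : eval e FTrue.
Proof. by apply/forallP => v /=. Qed.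

Lemma eval_FAll (G : sgraph) (e : assignment G) (s : seq formula) :
  eval e (FAll s) = all (eval e) s.
Proof. by elim: s => [|a s IH]; rewrite ?eval_FTrue //= IH. Qed.

Lemma eval_FAny (G : sgraph) (e : assignment G) (s : seq formula) :
  eval e (FAny s) = has (eval e) s.
Proof.
elim: s => [|a s IH] /=; last by rewrite IH.
by apply/negbTE; rewrite negbK; apply: eval_FTrue.
Qed.

Lemma eval_FExactly (G : sgraph) (e : assignment G) m x a :
  eval e (FExactly m x a) = (#|[pred v | eval (assign e x v) a]| == m).
Proof. by rewrite /= -leqNgt andbC -eqn_leq. Qed.

Definition two_var (d : nat) (fv : seq nat) (f : formula) : bool :=
  [&& qdepth f <= d, all (fun z => z < 2) (vars f)
    & all [in fv] (free_vars f)].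

Lemma two_varW d d' fv f : d <= d' -> two_var d fv f -> two_var d' fv f.
Proof. by move=> dd' /and3P[fd vf ff]; apply/and3P; split=> //; lia. Qed.

Lemma two_var_and d fv a b :
  two_var d fv a -> two_var d fv b -> two_var d fv (FAnd a b).
Proof.
case/and3P=> ? ? ? /and3P[? ? ?]; rewrite /two_var /= !all_cat geq_max.
by apply/and3P; split; apply/andP.
Qed.

Lemma two_var_imp d fv a b :
  two_var d fv a -> two_var d fv b -> two_var d fv (FImp a b).
Proof. exact: (@two_var_and d fv a b). Qed.

Lemma two_var_all d fv s :
  0 < d -> all (two_var d fv) s -> two_var d fv (FAll s).
Proof.
move=> d0; elim: s => [_|a s IH /= /andP[av /IH]]; first by rewrite /two_var /= d0.
exact: two_var_and.
Qed.

Lemma two_var_any d fv s :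
  0 < d -> all (two_var d fv) s -> two_var d fv (FAny s).
Proof.
move=> d0; elim: s => [_|a s IH /= /andP[av /IH]]; first by rewrite /two_var /= d0.
exact: two_var_and.
Qed.

Lemma two_var_forall d fv x a :
  x < 2 -> two_var d (x :: fv) a -> two_var d.+1 fv (FForall x a).
Proof.
move=> x2 /and3P[ad av af]; rewrite /two_var /= ltnS ad x2 av.
apply/allP => y; rewrite mem_filter => /andP[yx ya].
by have := allP af _ ya; rewrite inE (negbTE yx).
Qed.

Lemma two_var_exactly d fv x m a :
  x < 2 -> two_var d (x :: fv) a -> two_var d.+1 fv (FExactly m x a).
Proof.
by move=> x2 av; apply: two_var_and; apply: (two_var_forall x2 av).
Qed.

Definition degree_formula (d x y : nat) : formula := FExactly d y (FAdj x y).

(** Says that the colour of [x] is [c]. The inner degree formula for [y] quantifies the symbol [x]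
    again, so two symbols are enough, at depth 2. *)
Definition nbr_deg_formula (c : nat -> nat) (n x y : nat) : formula :=
  FAll [seq FExactly (c d) y (FAnd (FAdj x y) (degree_formula d y x))
       | d <- iota 0 n.+1].

Lemma eval_degree_formula (G : sgraph) (e : assignment G) d x y v :
  x != y -> e x = Some v -> eval e (degree_formula d x y) = (deg v == d).
Proof.
move=> xy ex; rewrite eval_FExactly; congr (_ == _); apply: eq_card => u.
by rewrite !inE /= /assign eqxx (negbTE xy) ex.
Qed.

Lemma eval_nbr_deg_formula (G : sgraph) (e : assignment G) c n x y v :
  x != y -> e x = Some v ->
  eval e (nbr_deg_formula c n x y)
  = all (fun d => nbr_deg v d == c d) (iota 0 n.+1).
Proof.
move=> xy ex; rewrite eval_FAll all_map; apply: eq_all => d.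
rewrite [LHS]eval_FExactly; congr (_ == _); apply: eq_card => u.
rewrite !inE [LHS]/= -[X in _ && X]/(eval _ (degree_formula d y x)).
rewrite (@eval_degree_formula _ _ _ _ _ u) ?[y == x]eq_sym ?(negbTE xy) //.
  by rewrite /assign eqxx (negbTE xy) ex.
by rewrite /assign eqxx.
Qed.

Lemma two_var_nbr_deg_formula c n x y :
  x < 2 -> y < 2 -> two_var 2 [:: x] (nbr_deg_formula c n x y).
Proof.
move=> x2 y2; apply: two_var_all => //; rewrite all_map; apply/allP => d _ /=.
apply: two_var_exactly => //; apply: two_var_and.
  by rewrite /two_var /= x2 y2 !inE !eqxx orbT.
by apply: two_var_exactly; rewrite // /two_var /= x2 y2 !inE !eqxx ?orbT.
Qed.

Lemma width_two_var d fv f : two_var d fv f -> width f <= 2.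
Proof.
case/and3P=> _ vf _; rewrite /width -[2]/(size [:: 0; 1]).
apply: uniq_leq_size; first exact: undup_uniq.
by move=> z; rewrite mem_undup => /(allP vf); case: z => [|[|]].
Qed.

(** Definability at a given depth asks for exactly that depth, so [f] is conjoined with a tautology
    [pad] of depth exactly [d.+1]. *)
Lemma definable_at_of_two_var d f (G : sgraph) :
  two_var d.+1 [::] f -> defines f G -> definable_at 2 d.+1 G.
Proof.
move=> fv fG.
pose pad := iter d.+1 (FForall 0) (FEq 0 0).
have pad_eval (H : sgraph) (e : assignment H) : eval e pad.
  rewrite /pad; elim: d {fv pad} e => [|d IH] e; first exact: eval_FTrue.
  by rewrite iterS; apply/forallP => v; apply: IH.
have pad_depth : qdepth pad = d.+1 by rewrite /pad; elim: d.+1 => //= m ->.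
have pad_vars : all (fun z => z < 2) (vars pad).
  by rewrite /pad; elim: d.+1 => //= m ->.
have pad_free : free_vars pad = [::].
  by rewrite /pad; elim: d {fv pad pad_eval pad_depth pad_vars} => // m /= ->.
have av : two_var d.+1 [::] (FAnd f pad).
  by apply: two_var_and => //; rewrite /two_var pad_depth leqnn pad_vars pad_free.
clearbody pad; exists (FAnd f pad); split.
- have /and3P[_ _] := av; rewrite /sentence.
  by case: (free_vars _).
- exact: width_two_var av.
- by rewrite /= pad_depth; apply/maxn_idPr; case/and3P: fv.
case: fG => Gf Hf; split=> [|H /Hf nHf].
  by rewrite /holds /= pad_eval andbT.
by rewrite /holds /= pad_eval andbT.
Qed.

(** The sentence [f] states that every vertex has a colour of [G], that each of these colours is
    taken, and exactly once, and that vertices of two given colours are adjacent as in [G]. Matching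
    colours is then an isomorphism. Colours cost depth 2 and the edge clauses two quantifiers
    more. *)
Lemma nbr_deg_separates_definable (G : sgraph) :
  nbr_deg_separates G -> definable_at 2 4 G.
Proof.
move=> sep.
pose n := #|G|; pose phi (v : G) x y := nbr_deg_formula (nbr_deg v) n x y.
pose lit (u v : G) := if adj u v then FAdj 0 1 else FNot (FAdj 0 1).
pose edge (u v : G) :=
  FForall 0 (FImp (phi u 0 1) (FForall 1 (FImp (phi v 1 0) (lit u v)))).
pose f := FAnd (FForall 0 (FAny [seq phi v 0 1 | v <- enum G]))
  (FAnd (FAll [seq FExists 0 (phi v 0 1) | v <- enum G])
  (FAnd (FAll [seq FExactly 1 0 (phi v 0 1) | v <- enum G])
        (FAll [seq edge uv.1 uv.2 | uv <- enum {: G * G}]))).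
pose agree (H : sgraph) (a : H) (v : G) :=
  all (fun d => nbr_deg a d == nbr_deg v d) (iota 0 n.+1).
have evphi (H : sgraph) (e : assignment H) v x y a : x != y ->
    e x = Some a -> eval e (phi v x y) = agree H a v.
  by move=> *; apply: eval_nbr_deg_formula.
have tphi v x y : x < 2 -> y < 2 -> two_var 2 [:: x] (phi v x y).
  exact: two_var_nbr_deg_formula.
clearbody phi; have agreeG (a v : G) : agree G a v = (a == v).
  apply/idP/eqP => [/allP av|->]; last by apply/allP => d _.
  by apply: sep; apply/forallP => d; apply: av; rewrite mem_iota /= add0n.
have holdsE (H : sgraph) : holds H f =
  [&& [forall a : H, has (agree H a) (enum G)],
      all (fun v => [exists a : H, agree H a v]) (enum G),
      all (fun v => #|[pred a : H | agree H a v]| == 1) (enum G) &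
      all (fun uv : G * G => [forall a : H, agree H a uv.1 ==>
         [forall b : H, agree H b uv.2 ==> (adj a b == adj uv.1 uv.2)]])
        (enum {: G * G})].
  rewrite /holds /f; congr [&& _, _, _ & _].
  - apply: eq_forallb => a; rewrite [LHS]eval_FAny has_map; apply: eq_has => v.
    by rewrite [LHS](evphi _ _ _ _ _ a).
  - rewrite [LHS]eval_FAll all_map; apply: eq_all => v; apply: eq_existsb => a.
    by rewrite [LHS](evphi _ _ _ _ _ a).
  - rewrite [LHS]eval_FAll all_map; apply: eq_all => v; rewrite [LHS]eval_FExactly.
    congr (_ == _); apply: eq_card => a; rewrite !inE.
    by rewrite [LHS](evphi _ _ _ _ _ a).
  - rewrite [LHS]eval_FAll all_map; apply: eq_all => -[u v].
    apply: eq_forallb => a; congr (_ ==> _); first exact: evphi.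
    apply: eq_forallb => b; congr (_ ==> _); first exact: evphi.
    by rewrite /lit /=; case: (adj u v) => /=; case: (adj a b).
apply: (@definable_at_of_two_var _ f); last split.
- do 3?apply: two_var_and.
  + apply: two_var_forall => //; apply: two_var_any => //.
    by rewrite all_map; apply/allP => v _; apply: two_varW (tphi _ _ _ _ _).
  + apply: two_var_all => //; rewrite all_map; apply/allP => v _.
    by apply: (@two_varW 3) => //; apply: two_var_forall => //; apply: tphi.
  + apply: two_var_all => //; rewrite all_map; apply/allP => v _.
    by apply: (@two_varW 3) => //; apply: two_var_exactly => //; apply: tphi.
  + apply: two_var_all => //; rewrite all_map; apply/allP => -[u v] _.
    apply: two_var_forall => //; apply: two_var_imp.
      by apply: two_varW (tphi _ _ _ _ _).
    apply: two_var_forall => //; apply: two_var_imp.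
      have /and3P[h1 h2 h3] := tphi v 1 0 isT isT; apply/and3P; split=> //.
      by apply: sub_all h3 => z; rewrite !inE => ->.
    by rewrite /lit; case: ifP.
- rewrite holdsE; apply/and4P; split.
  + apply/forallP => a; apply/hasP; exists a; first exact: mem_enum.
    by rewrite agreeG.
  + by apply/allP => v _; apply/existsP; exists v; rewrite agreeG.
  + apply/allP => v _; rewrite -(card1 v); apply/eqP; apply: eq_card => a.
    by rewrite !inE agreeG.
  + apply/allP => -[u v] _ /=; apply/forallP => a; apply/implyP.
    rewrite agreeG => /eqP ->; apply/forallP => b; apply/implyP.
    by rewrite agreeG => /eqP ->.
move=> H nGH; rewrite holdsE => /and4P[/forallP H1 /allP H2 /allP H3 /allP H4].
apply: nGH.
have ex v : exists a, agree H a v by apply/existsP; apply: H2; rewrite mem_enum.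
(* The isomorphism sends [v] to the vertex of [H] with the same counts for all [d <= n]. *)
pose F v := xchoose (ex v).
have FP v : agree H (F v) v := xchooseP (ex v).
have uniqH v a b : agree H a v -> agree H b v -> a = b.
  move=> av bv; have := H3 v (mem_enum _ v); move/eqP/mem_card1 => [c cP].
  by move: (cP a) (cP b); rewrite !inE av bv => /esym/eqP-> /esym/eqP->.
have Hsep a u v : agree H a u -> agree H a v -> u = v.
  move=> /allP au /allP av; apply: sep; apply/forallP => d.
  have dn : (d : nat) \in iota 0 n.+1 by rewrite mem_iota /= add0n.
  by rewrite -(eqP (au _ dn)) -(eqP (av _ dn)).
have exK a : exists v, agree H a v by have /hasP[v] := H1 a; exists v.
exists F.
  exists (fun a => xchoose (exK a)) => [v|a].
    exact: Hsep (xchooseP (exK (F v))) (FP v).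
  exact: uniqH (FP _) (xchooseP (exK a)).
move=> u v; have := H4 (u, v) (mem_enum _ _).
move=> /forallP /(_ (F u)) /implyP /(_ (FP u)) /forallP /(_ (F v)).
by move=> /implyP /(_ (FP v)) /eqP.
Qed.

End Logic.

(** * Depth 3 does not suffice *)

Section Equivalence.
Local Open Scope nat_scope.

Lemma eq_card_bij (V W : finType) (h : V -> W) (P : pred V) (Q : pred W) :
  bijective h -> (forall v, P v = Q (h v)) -> #|P| = #|Q|.
Proof.
move=> hb PQ; rewrite -(fintype.card_image (bij_inj hb) P).
case: hb => h' hK h'K; apply: eq_card => v.
apply/fintype.imageP/idP => [[u Pu ->]|Qv]; first by rewrite -[_ \in Q]PQ.
by exists (h' v); rewrite ?h'K // -[_ \in P]/(P _) PQ h'K.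
Qed.

(** Each colour class of [f] is matched with the class of [g] of the same size by position in the
    enumerations. The default of [nth] is never reached. *)
Lemma colour_preserving_bijection (V : finType) (C : eqType) (f g : V -> C) :
  (forall c, #|[pred v | f v == c]| = #|[pred v | g v == c]|) ->
  exists2 h : V -> V, bijective h & forall v, g (h v) = f v.
Proof.
pose A (k : V -> C) c := enum [pred v | k v == c].
pose h (k l : V -> C) v := nth v (A l (k v)) (index v (A k (k v))).
have hP k l v : (forall c, #|[pred v | k v == c]| = #|[pred v | l v == c]|) ->
    l (h k l v) = k v /\ h l k (h k l v) = v.
  move=> cnt; have vA : v \in A k (k v) by rewrite mem_enum inE.
  have lt : index v (A k (k v)) < size (A l (k v)).
    by rewrite -cardE -cnt cardE index_mem.
  have lh : l (h k l v) = k v.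
    by have := mem_nth v lt; rewrite -/(h k l v) mem_enum inE => /eqP.
  split=> //; rewrite /h -/(h k l v) lh /h index_uniq ?enum_uniq //.
  by rewrite (set_nth_default v) ?index_mem // nth_index.
move=> cnt; exists (h f g); last by move=> v; have [] := hP f g v cnt.
exists (h g f) => v; first by have [] := hP f g v cnt.
by have [] := hP g f v (fun c => esym (cnt c)).
Qed.

Section TwoGraphs.
Variables (V : finType) (adjG adjH : rel V).
Hypotheses (symG : symmetric adjG) (irrG : irreflexive adjG).
Hypotheses (symH : symmetric adjH) (irrH : irreflexive adjH).
Let G := SGraph symG irrG.
Let H := SGraph symH irrH.

(* Non-neighbours of a given colour are counted by complement. *)
Lemma type_preserving_bijection (cG cH : V -> nat) (a b : V) :
  (forall d, #|[pred v | cG v == d]| = #|[pred v | cH v == d]|) ->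
  cG a = cH b ->
  (forall d, #|[pred v | adjG a v & cG v == d]|
           = #|[pred v | adjH b v & cH v == d]|) ->
  exists2 h : V -> V, bijective h &
    forall v, [/\ (h v == b) = (v == a), adjH b (h v) = adjG a v
                 & cH (h v) = cG v].
Proof.
move=> cnt cab cntN.
(* The colours are refined by recording equality with and adjacency to the fixed vertex. *)
have [|h hb hP] := @colour_preserving_bijection V _
    (fun v => (v == a, adjG a v, cG v)) (fun v => (v == b, adjH b v, cH v)).
  have split_adj (E : rel V) (irr : irreflexive E) (c : V -> nat) x d :
      #|[pred v | c v == d]| = (c x == d) + #|[pred v | E x v & c v == d]|
      + #|[pred v | (v == x, E x v, c v) == (false, false, d)]|.
    rewrite (cardD1 x) -(cardID [pred v | E x v]) -addnA inE; congr (_ + _).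
    congr (_ + _); apply: eq_card => v; rewrite !inE ?xpair_eqE.
      by case: (eqVneq v x) => [->|_]; rewrite ?irr // andbC.
    by rewrite !eqbF_neg; case: (v != x); case: (E x v).
  have card_eq (E : rel V) (irr : irreflexive E) (c : V -> nat) x d :
      #|[pred v | (v == x, E x v, c v) == (true, false, d)]| = (c x == d).
    rewrite (cardD1 x) !inE !xpair_eqE eqxx irr /= eq_card0 ?addn0 // => v.
    by rewrite !inE !xpair_eqE; case: (v == x).
  have card_adj (E : rel V) (irr : irreflexive E) (c : V -> nat) x d :
      #|[pred v | (v == x, E x v, c v) == (false, true, d)]| = #|[pred v | E x v
        & c v == d]|.
    by apply: eq_card => v; rewrite !inE !xpair_eqE;
      case: (eqVneq v x) => [->|_]; rewrite ?irr //; case: (E x v).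
  have card_none (E : rel V) (irr : irreflexive E) (c : V -> nat) x d :
      #|[pred v | (v == x, E x v, c v) == (true, true, d)]| = 0.
    by apply: eq_card0 => v; rewrite !inE !xpair_eqE;
      case: (eqVneq v x) => [->|_]; rewrite ?irr //; case: (E x v).
  move=> [[[] []] d].
  - by rewrite !card_none.
  - by rewrite !card_eq // cab.
  - by rewrite !card_adj.
  - have := cnt d; rewrite (split_adj adjG irrG _ a) (split_adj adjH irrH _ b).
    by rewrite cab cntN => /addnI.
exists h => // v.
by have /eqP := hP v; rewrite !xpair_eqE => /andP[/andP[/eqP-> /eqP->] /eqP->].
Qed.

Definition atom_type (E : rel V) (u v : option V) : option (bool * bool) :=
  if (u, v) is (Some a, Some b) then Some (a == b, E a b) else None.

Hypothesis deg_eq : forall v, @deg G v = @deg H v.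
Hypothesis nbr_deg_eq : forall v d, @nbr_deg G v d = @nbr_deg H v d.

Section Vars.
Variables p q : nat.
Hypothesis pq : p != q.

Definition indist0 (e e' : nat -> option V) : Prop :=
  forall x y, x \in [:: p; q] -> y \in [:: p; q] ->
    atom_type adjG (e x) (e y) = atom_type adjH (e' x) (e' y).

(** One remaining quantifier can count the neighbours of an assigned vertex, hence the degrees; with
    two, as in [indist2], it can count the neighbours of each degree. *)
Definition indist1 (e e' : nat -> option V) : Prop :=
  indist0 e e' /\
  forall x, x \in [:: p; q] -> omap (@deg G) (e x) = omap (@deg H) (e' x).

Definition indist2 (e e' : nat -> option V) : Prop :=
  indist1 e e' /\
  forall x d, x \in [:: p; q] ->
    omap (fun v => @nbr_deg G v d) (e x) = omap (fun v => @nbr_deg H v d) (e' x).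

(** All three quantifiers remain only at the start, when neither symbol is assigned. *)
Definition indist3 (e e' : nat -> option V) : Prop :=
  forall x, x \in [:: p; q] -> e x = None /\ e' x = None.

(* Two assignments are indistinguishable with k further quantifiers. *)
Definition indist (k : nat) : (nat -> option V) -> (nat -> option V) -> Prop :=
  match k with 0 => indist0 | 1 => indist1 | 2 => indist2 | _ => indist3 end.

Lemma indist_atom k e e' : indist k e e' -> indist0 e e'.
Proof.
case: k => [|[|[|k]]] //=; [by case|by case=> -[]|].
by move=> ee x y /ee[-> ->] /ee[-> ->].
Qed.

Lemma indist0_assign e e' z v v' :
  indist0 e e' -> z \in [:: p; q] ->
  (forall y, y \in [:: p; q] -> y != z ->
     atom_type adjG (Some v) (e y) = atom_type adjH (Some v') (e' y)) ->
  indist0 (@assign G e z v) (@assign H e' z v').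
Proof.
move=> ee zpq vv x y xpq ypq; rewrite /assign.
case: (eqVneq x z) => [xz|xz]; case: (eqVneq y z) => [yz|yz].
- by rewrite /atom_type !eqxx irrG irrH.
- exact: vv.
- have := vv x xpq xz; rewrite /atom_type.
  case: (e x) => [a|]; case: (e' x) => [a'|] //=.
  by rewrite (eq_sym v) (eq_sym v') symG (symH v').
- exact: ee.
Qed.

Definition other z := if z == p then q else p.

Lemma otherP z y : z \in [:: p; q] -> y \in [:: p; q] -> y != z -> y = other z.
Proof.
rewrite !inE /other => /orP[]/eqP-> /orP[]/eqP->; rewrite ?eqxx //.
by move=> _; rewrite eq_sym (negbTE pq).
Qed.

Lemma mem_other z : other z \in [:: p; q].
Proof. by rewrite /other; case: ifP; rewrite !inE eqxx ?orbT. Qed.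

(** Assigning [z] forgets its old value, so only the vertex held by the other symbol constrains the
    bijection; if that symbol is unassigned, the identity works. The colours [cG] and [cH] are what
    must still agree after the move. *)
Lemma back_and_forth_from (cG cH : V -> nat) e e' z :
  z \in [:: p; q] -> indist0 e e' ->
  (forall d, #|[pred v | cG v == d]| = #|[pred v | cH v == d]|) ->
  (forall v, cG v = cH v) ->
  (forall a b, e (other z) = Some a -> e' (other z) = Some b -> 
    cG a = cH b /\
    forall d, #|[pred v | adjG a v & cG v == d]|
           = #|[pred v | adjH b v & cH v == d]|) ->
  exists2 h : V -> V, bijective h &
    forall v, indist0 (@assign G e z v) (@assign H e' z (h v)) /\ cG v = cH (h v).
Proof.
move=> zpq ee cnt cGH ab.
have := ee _ _ (mem_other z) (mem_other z); rewrite /atom_type.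
case ea: (e (other z)) => [a|]; case eb: (e' (other z)) => [b|] // _; last first.
  exists id; first by exists id.
  move=> v; split=> //; apply: indist0_assign => // y ypq yz.
  by rewrite (otherP zpq ypq yz) ea eb.
have [cab cntN] := ab _ _ ea eb.
have [h hb hP] := type_preserving_bijection cnt cab cntN.
exists h => // v; have [h1 h2 h3] := hP v; split=> //.
apply: indist0_assign => // y ypq yz; rewrite (otherP zpq ypq yz) ea eb.
by rewrite /atom_type h1 symG (symH (h v)) h2.
Qed.

Lemma back_and_forth k e e' z :
  z \in [:: p; q] -> k < 3 -> indist k.+1 e e' ->
  exists2 h : V -> V, bijective h &
    forall v, indist k (@assign G e z v) (@assign H e' z (h v)).
Proof.
have om (x y : V) (f g : V -> nat) (E E' : nat -> option V) (t : nat) :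
  (t \in [:: p; q] -> omap f (E t) = omap g (E' t)) -> f x = g y ->
  t \in [:: p; q] ->
  omap f (@assign G E z x t) = omap g (@assign H E' z y t).
  by move=> EE fg tpq; rewrite /assign; case: ifP => _ /=; [rewrite fg|apply: EE].
move=> zpq; case: k => [|[|[|//]]] _.
- move=> [ee dd].
  (* With no quantifier left only atoms matter: the colour is constant, and the condition on
     neighbours becomes equality of degrees. *)
  have [//|//|a b ea eb|h hb hP] := @back_and_forth_from (fun=> 0) (fun=> 0) e e'
    z zpq ee.
    split=> // d; have := dd _ (mem_other z); rewrite ea eb /= => -[].
    rewrite /deg /=; case: (eqVneq 0 d) => d0 dab.
      transitivity #|[pred y | adjG a y]|; first by apply: eq_card => v;
        rewrite !inE andbT.
      by rewrite dab; apply: eq_card => v; rewrite !inE andbT.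
    by rewrite !eq_card0 // => v; rewrite !inE andbF.
  by exists h => // v; have [] := hP v.
- move=> [[ee dd] nn].
  (* With degrees as colours, the condition on neighbours is the assumed equality of [nbr_deg]. *)
  have [||a b ea eb|h hb hP] := @back_and_forth_from (@deg G) (@deg H) e e' z zpq
    ee.
  + by move=> d; apply: eq_card => v; rewrite !inE deg_eq.
  + exact: deg_eq.
  + split; first by have := dd _ (mem_other z); rewrite ea eb => -[].
    by move=> d; have := nn _ d (mem_other z); rewrite ea eb => -[].
  exists h => // v; have [h1 h2] := hP v; split=> // x xpq.
  by apply: om => //; apply: dd.
(* First move: the identity answers, since both graphs give each vertex the same degree and
   colour. *)
- move=> ee; exists id; first by exists id.
  move=> v; split; first split.
  + apply: indist0_assign => //; first exact: (@indist_atom 3).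
    by move=> y /ee[-> ->].
  + by move=> x xpq; apply: om => // /ee[-> ->].
  + by move=> x d xpq; apply: om => // /ee[-> ->].
Qed.

(** The bijection supplied for a quantifier carries the vertices satisfying the body in one graph
    onto those in the other, which settles existential, universal and counting quantifiers alike. *)
Lemma eval_indist f k e e' :
  {subset vars f <= [:: p; q]} -> qdepth f <= k -> k <= 3 -> indist k e e' ->
  @eval G e f = @eval H e' f.
Proof.
have quant (a : formula) x k' (E E' : nat -> option V) :
    (forall k e e', {subset vars a <= [:: p; q]} -> qdepth a <= k -> k <= 3 ->
      indist k e e' -> @eval G e a = @eval H e' a) ->
    {subset x :: vars a <= [:: p; q]} -> qdepth a < k' -> k' <= 3 ->
    indist k' E E' -> exists2 h : V -> V, bijective h &
    forall v, @eval G (@assign G E x v) a = @eval H (@assign H E' x (h v)) a.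
  case: k' => // k' IH sub ak k3 EE.
  have [|//|h hb hP] := @back_and_forth k' E E' x _ _ EE; first by apply: sub;
    rewrite inE eqxx.
  exists h => // v; apply: (IH k') => //; last by apply: ltnW.
  by move=> y ya; apply: sub; rewrite inE ya orbT.
elim: f k e e' => [x y|x y|a IH|a IHa b IHb|a IHa b IHb|a IHa b IHb|a IHa b IHb
    |x a IH|x a IH|m x a IH] k e e' sub dk k3 ee;
  do ?[have suba : {subset vars a <= [:: p; q]} by
         move=> z za; apply: sub; rewrite /= ?mem_cat ?za];
  do ?[have subb : {subset vars b <= [:: p; q]} by
         move=> z za; apply: sub; rewrite /= mem_cat za orbT];
  do ?[have /andP[dka dkb] : (qdepth a <= k) && (qdepth b <= k) by rewrite
    -geq_max].
- have := indist_atom ee (sub x _) (sub y _);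
    rewrite /= !inE !eqxx orbT => /(_ isT isT).
  by rewrite /atom_type; case: (e x) => [?|]; case: (e y) => [?|];
    case: (e' x) => [?|]; case: (e' y) => [?|] //= [].
- have := indist_atom ee (sub x _) (sub y _);
    rewrite /= !inE !eqxx orbT => /(_ isT isT).
  by rewrite /atom_type; case: (e x) => [?|]; case: (e y) => [?|];
    case: (e' x) => [?|]; case: (e' y) => [?|] //= [].
- by rewrite /= (IH k e e').
- by rewrite /= (IHa k e e') ?(IHb k e e').
- by rewrite /= (IHa k e e') ?(IHb k e e').
- by rewrite /= (IHa k e e') ?(IHb k e e').
- by rewrite /= (IHa k e e') ?(IHb k e e').
- have [h [h' hK h'K] hP] := quant a x k e e' IH sub dk k3 ee.
  apply/existsP/existsP => -[v vP]; first by exists (h v);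
    apply: etrans (esym (hP v)) vP.
  by exists (h' v); apply: etrans (hP _) _; rewrite h'K.
- have [h [h' hK h'K] hP] := quant a x k e e' IH sub dk k3 ee.
  apply/forallP/forallP => vP v; last by apply: etrans (hP v) (vP _).
  by rewrite -[v]h'K; apply: etrans (esym (hP _)) (vP _).
- have [h hb hP] := quant a x k e e' IH sub dk k3 ee.
  by congr (m <= _); apply: (eq_card_bij hb).
Qed.
End Vars.
End TwoGraphs.
End Equivalence.

(** * Switching an alternating 4-cycle *)

Section LowerBound.
Local Open Scope nat_scope.

Lemma holds_depth3 (G : sgraph) (E' : rel G) (sE' : symmetric E')
    (iE' : irreflexive E') (H := SGraph sE' iE') (f : formula) :
  (forall v : G, deg v = @deg H v) ->
  (forall (v : G) d, nbr_deg v d = @nbr_deg H v d) ->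
  width f <= 2 -> qdepth f <= 3 -> holds G f = holds H f.
Proof.
rewrite {}/H; case: G E' sE' iE' => V E sE iE E' sE' iE' degE ndE wf df.
(* If fewer than two symbols occur, others are added to have two distinct ones. *)
have [p [q [pq sub]]] : exists p q, p != q /\ {subset vars f <= [:: p; q]}.
  move: wf; rewrite /width; have sub := mem_undup (vars f); move: sub.
  case: (undup _) (undup_uniq (vars f)) => [|x [|y [|]]] //= u sub _.
  - by exists 0, 1; split=> // z; rewrite -sub.
  - exists x, x.+1; split; first by rewrite neq_ltn ltnSn.
    by move=> z; rewrite -sub !inE => ->.
  - exists x, y; split; first by move: u; rewrite inE andbT.
    by move=> z; rewrite -sub.
exact: (@eval_indist V E E' sE iE sE' iE' degE ndE p q pq f 3).
Qed.

(* Switching the alternating 4-cycle [a b d c] keeps all degrees; as opposite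
   vertices have equal degrees, it also keeps the degrees of the neighbours. *)
Definition switchable (G : sgraph) : Prop :=
  exists a b c d : G,
    [/\ deg a = deg d, deg b = deg c, a != c, d != b
      & [&& adj a b, adj d c, ~~ adj a c & ~~ adj d b]].

Section Switch.
Variables (G : sgraph) (a b c d : G).
Hypotheses (dad : deg a = deg d) (dbc : deg b = deg c).
Hypotheses (ac : a != c) (db : d != b).
Hypotheses (ab : adj a b) (dc : adj d c) (nac : ~~ adj a c) (ndb : ~~ adj d b).

(* Switching amounts to exchanging [b] and [c] as seen from [a] and [d], and
   [a] and [d] as seen from [b] and [c]. *)
Definition switch_at (x : G) : {perm G} :=
  if x \in [:: a; d] then tperm b c
  else if x \in [:: b; c] then tperm a d else 1%g.

Definition switch_adj : rel G := fun x y => adj x (switch_at x y).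

Let neqs : [/\ a != b, d != c, a != d & b != c].
Proof.
split; apply/eqP => e.
- by move: ab; rewrite e adj_irrefl.
- by move: dc; rewrite e adj_irrefl.
- by move: ab; rewrite e (negbTE ndb).
- by move: ab; rewrite e (negbTE nac).
Qed.

(** In this form, where exactly the four pairs between [{a, d}] and [{b, c}] are complemented,
    symmetry and irreflexivity become visible. *)
Lemma switch_adjE x y : switch_adj x y =
  adj x y (+) ((x \in [:: a; d]) && (y \in [:: b; c])
            || (y \in [:: a; d]) && (x \in [:: b; c])).
Proof.
have [nab ndc nad nbc] := neqs.
have s := (@adj_sym G); rewrite /switch_adj /switch_at !inE.
have [-> /=|xa] := eqVneq x a.
  rewrite (negbTE nab) (negbTE ac) andbF orbF.
  case: tpermP => [->|->|/eqP/negbTE-> /eqP/negbTE->];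
    rewrite ?eqxx ?orbT ?addbF //.
    by rewrite ab (negbTE nac).
  by rewrite ab (negbTE nac).
have [-> /=|xd] := eqVneq x d.
  rewrite (negbTE db) (negbTE ndc) andbF orbF.
  case: tpermP => [->|->|/eqP/negbTE-> /eqP/negbTE->];
    rewrite ?eqxx ?orbT ?addbF //.
    by rewrite dc (negbTE ndb).
  by rewrite dc (negbTE ndb).
have [-> /=|xb] := eqVneq x b.
  case: tpermP => [->|->|/eqP/negbTE-> /eqP/negbTE->];
    rewrite ?eqxx ?orbT ?addbF //.
    by rewrite ![adj b _]s ab (negbTE ndb).
  by rewrite ![adj b _]s ab (negbTE ndb).
have [-> /=|xc] := eqVneq x c.
  case: tpermP => [->|->|/eqP/negbTE-> /eqP/negbTE->];
    rewrite ?eqxx ?orbT ?addbF //.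
    by rewrite ![adj c _]s dc (negbTE nac).
  by rewrite ![adj c _]s dc (negbTE nac).
by rewrite /= perm1 andbF addbF.
Qed.

Lemma switch_adj_sym : symmetric switch_adj.
Proof.
move=> x y; rewrite !switch_adjE adj_sym; congr (_ (+) _).
by rewrite orbC.
Qed.

Lemma switch_adj_irrefl : irreflexive switch_adj.
Proof.
have [nab ndc nad nbc] := neqs.
move=> x; rewrite switch_adjE adj_irrefl orbb !inE.
have [->|xa] := eqVneq x a; first by rewrite (negbTE nab) (negbTE ac).
by have [->|xd] := eqVneq x d; first by rewrite (negbTE db) (negbTE ndc).
Qed.

Definition switch : sgraph := SGraph switch_adj_sym switch_adj_irrefl.

Lemma deg_switch_at x y : deg (switch_at x y) = deg y.
Proof.
rewrite /switch_at; case: ifP => _; last case: ifP => _; last by rewrite perm1.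
  by case: tpermP => [->|->|].
by case: tpermP => [->|->|].
Qed.

(** The permutation [switch_at x] maps the new neighbours of [x] onto the old ones. As it only
    exchanges vertices of equal degree, the same map also preserves colours. *)
Lemma deg_switch x : @deg switch x = @deg G x.
Proof.
apply: (@eq_card_bij switch G (switch_at x)); first exact: injF_bij perm_inj.
by move=> y.
Qed.

Lemma nbr_deg_switch x k : @nbr_deg switch x k = @nbr_deg G x k.
Proof.
apply: (@eq_card_bij _ _ (switch_at x)); first exact: injF_bij perm_inj.
by move=> y /=; rewrite deg_switch deg_switch_at.
Qed.

(** An isomorphism preserves colours, the switch keeps the colour of each vertex, and colours are
    distinct, so the isomorphism would be the identity; but the edge [ab] has been removed. *)
Lemma switch_not_isomorphic : nbr_deg_separates G -> ~ isomorphic G switch.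
Proof.
move=> sep [h hb hadj].
have hdeg x : @deg switch (h x) = @deg G x.
  by apply/esym/(eq_card_bij hb) => y /=; rewrite -hadj.
have hid x : h x = x.
  apply: sep; apply/forallP => k; rewrite -nbr_deg_switch eq_sym; apply/eqP.
  by apply/(eq_card_bij hb) => y /=; rewrite -hadj hdeg.
have := hadj a b; rewrite !hid /= switch_adjE ab !inE !eqxx.
by [].
Qed.

Lemma not_definable_depth3 k :
  nbr_deg_separates G -> k <= 3 -> ~ definable_at 2 k G.
Proof.
move=> sep k3 [f [_ wf df [Gf Hf]]].
apply: (Hf switch); first exact: switch_not_isomorphic.
rewrite -(@holds_depth3 G) //; last by rewrite df.
  by move=> v; rewrite deg_switch.
by move=> v i; rewrite nbr_deg_switch.
Qed.
End Switch.

Lemma counting_depth_eq4 (G : sgraph) :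
  nbr_deg_separates G -> switchable G -> counting_depth 2 G = Some 4.
Proof.
move=> sep [a [b [c [d [dad dbc ac db /and4P[ab dc nac ndb]]]]]].
rewrite /counting_depth; case: pselect => [h|[]]; last first.
  by exists 4; apply/asboolP; apply: nbr_deg_separates_definable.
congr Some; case: ex_minnP => m /asboolP mdef mmin.
apply/eqP; rewrite eqn_leq mmin /=; last first.
  by apply/asboolP; apply: nbr_deg_separates_definable.
rewrite ltnNge; apply/negP => m3.
exact: (@not_definable_depth3 G a b c d dad dbc ac db ab dc nac ndb m sep m3 mdef).
Qed.
End LowerBound.

(** * Resampling random bits *)

Section RandomBits.
Variables (R : realType) (I : finType).
Implicit Types (w s : {ffun I -> bool}) (F H : pred {ffun I -> bool}).

Definition pr F : R := #|F|%:R / 2 ^+ #|I|.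

Definition resample (S : {set I}) w s : {ffun I -> bool} :=
  [ffun i => if i \in S then s i else w i].

Let card_bits : #|{ffun I -> bool}|%:R = 2 ^+ #|I| :> R.
Proof. by rewrite card_ffun card_bool natrX. Qed.

Let tot_gt0 : 0 < 2 ^+ #|I| :> R. Proof. by rewrite exprn_gt0. Qed.

Lemma pr_ge0 F : 0 <= pr F.
Proof. by rewrite divr_ge0 // ltW. Qed.

Lemma le_pr F H : (forall w, F w -> H w) -> pr F <= pr H.
Proof.
move=> FH; rewrite ler_pM2r ?invr_gt0 // ler_nat.
by apply: subset_leq_card; apply/fintype.subsetP.
Qed.

Lemma eq_pr F H : F =1 H -> pr F = pr H.
Proof. by move=> FH; rewrite /pr (eq_card FH). Qed.

Lemma prC F : pr (predC F) = 1 - pr F.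
Proof.
apply/eqP; rewrite eq_sym subr_eq addrC -mulrDl -natrD cardC card_bits divff //.
Qed.

Lemma pr_le1 F : pr F <= 1.
Proof. by have := pr_ge0 (predC F); rewrite prC subr_ge0. Qed.

Lemma pr_pred0 F : (forall w, ~~ F w) -> pr F = 0.
Proof.
by move=> F0; rewrite /pr eq_card0 ?mul0r // => w; apply/negbTE/F0.
Qed.

Lemma prU F H : pr (predU F H) <= pr F + pr H.
Proof. by rewrite -mulrDl ler_pM2r ?invr_gt0 // -natrD ler_nat -cardUI leq_addr.
  Qed.

Lemma pr_exists (J : finType) (F : J -> pred {ffun I -> bool}) :
  pr [pred w | [exists j, F j w]] <= \sum_j pr (F j).
Proof.
rewrite -mulr_suml ler_pM2r ?invr_gt0 // -natr_sum ler_nat.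
have -> : (\sum_j #|F j| = \sum_j \sum_w F j w)%N.
  by apply: eq_bigr => j _; rewrite -sum1_card big_mkcond; apply: eq_bigr.
rewrite -sum1_card exchange_big /= big_mkcond /=; apply: leq_sum => w _.
by rewrite inE; case: existsP => // -[j Fj]; rewrite (bigD1 j) //= Fj.
Qed.

(* The map (w, s) |-> (resample w s, resample s w) is an involution, as the
   resampled set does not depend on the bits which are resampled. *)
Lemma pr_resample (S : {ffun I -> bool} -> {set I}) F H :
  (forall w s, S (resample (S w) w s) = S w) ->
  (forall w s, F (resample (S w) w s) = F w) ->
  pr (predI F H) =
    (\sum_(w | F w) pr (fun s => H (resample (S w) w s))) / 2 ^+ #|I|.
Proof.
move=> Sinv Finv; rewrite -mulr_suml /pr; congr (_ / _).
apply: (@mulIf _ (2 ^+ #|I|)); first by rewrite gt_eqF.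
rewrite mulfVK ?gt_eqF // -card_bits -natrM -natr_sum; congr (_%:R).
pose f (ws : {ffun I -> bool} * {ffun I -> bool}) :=
  (resample (S ws.1) ws.1 ws.2, resample (S ws.1) ws.2 ws.1).
have fK : involutive f.
  move=> [w s]; rewrite /f /= !Sinv; congr (_, _); apply/ffunP => i; rewrite !ffunE.
    by case: (i \in S w).
  by case: (i \in S w).
transitivity (\sum_(ws : {ffun I -> bool} * {ffun I -> bool} | predI F H ws.1) 1)%N.
  rewrite (eq_bigl (fun ws => predI F H ws.1 && predT ws.2)); last first.
    by move=> ws; rewrite andbT.
  rewrite -(pair_big (predI F H) predT (fun _ _ => 1)%N) /= sum_nat_const.
  by rewrite sum1_card.
rewrite (reindex_inj (inv_inj fK)) /=.
rewrite (eq_bigl (fun ws => F ws.1 && H (resample (S ws.1) ws.1 ws.2))); last first.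
  by move=> [w s] /=; rewrite Finv.
rewrite -(pair_big_dep F (fun w s => H (resample (S w) w s)) (fun _ _ => 1)%N) /=.
by apply: eq_bigr => w _; rewrite sum1_card.
Qed.

(** A bound on conditional probability: [S] and [F] are determined by the bits that are kept, and
    given those bits [H] has probability at most [q]. The set [S w] may itself be random. *)
Lemma pr_resample_le (S : {ffun I -> bool} -> {set I}) (q : R) F H :
  (forall w s, S (resample (S w) w s) = S w) ->
  (forall w s, F (resample (S w) w s) = F w) ->
  (forall w, F w -> pr (fun s => H (resample (S w) w s)) <= q) ->
  pr (predI F H) <= q * pr F.
Proof.
move=> Sinv Finv q_ge; rewrite (pr_resample _ Sinv Finv) mulrA.
rewrite ler_pM2r ?invr_gt0 // mulr_natr -sumr_const; exact: ler_sum.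
Qed.

Lemma pr_resample_ge (S : {ffun I -> bool} -> {set I}) (q : R) F H :
  (forall w s, S (resample (S w) w s) = S w) ->
  (forall w s, F (resample (S w) w s) = F w) ->
  (forall w, F w -> q <= pr (fun s => H (resample (S w) w s))) ->
  q * pr F <= pr (predI F H).
Proof.
move=> Sinv Finv q_ge; rewrite (pr_resample _ Sinv Finv) mulrA.
rewrite ler_pM2r ?invr_gt0 // mulr_natr -sumr_const; exact: ler_sum.
Qed.

(** Stands in for independence: each event is unlikely whatever the bits outside its own [S j], and
    no other event reads the bits of [S j]. Events are peeled off one at a time. *)
Lemma pr_all_le (J : eqType) (r : seq J) (S : J -> {set I})
    (F : J -> pred {ffun I -> bool}) (q : R) :
  uniq r -> 0 <= q ->
  {in r, forall j w, pr (fun s => F j (resample (S j) w s)) <= q} ->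
  {in r &, forall i j, i != j ->
     forall w s, F i (resample (S j) w s) = F i w} ->
  pr [pred w | all (fun j => F j w) r] <= q ^+ size r.
Proof.
move=> + q0; elim: r => [_ _ _|j r IH /= /andP[jr ur] Fq Finv]; first exact: pr_le1.
have {}IH : pr [pred w | all (fun j => F j w) r] <= q ^+ size r.
  apply: IH => // [i ir|i k ir kr]; first by apply: Fq; rewrite inE ir orbT.
  by apply: Finv; rewrite inE ?ir ?kr orbT.
rewrite exprS; apply: (le_trans _ (ler_wpM2l q0 IH)).
rewrite (@eq_pr _ (predI [pred w | all (fun j => F j w) r] (F j))).
  apply: (@pr_resample_le (fun=> S j)) => // [w s|w _].
    apply: eq_in_all => i ir; apply: Finv; rewrite ?inE ?eqxx ?ir ?orbT //.
    by apply: contraNneq jr => <-.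
  by apply: Fq; rewrite inE eqxx.
by move=> w /=; rewrite andbC.
Qed.

(** Flipping bit [i] exchanges the event with its complement. *)
Lemma pr_bit (i : I) (b : bool) : pr (fun s => s i == b) = 2^-1.
Proof.
pose f s : {ffun I -> bool} := [ffun k => if k == i then ~~ s k else s k].
have fK : involutive f.
  by move=> s; apply/ffunP => k; rewrite !ffunE; case: (k == i); rewrite ?negbK.
have := prC (fun s => s i == b).
rewrite {1}/pr (@eq_card_bij _ _ f _ (fun s => s i == b)) -/(pr _); last first.
- by move=> s; rewrite /= ffunE eqxx; case: (s i); case: b.
- by exists f.
by lra.
Qed.

End RandomBits.

(** * Anticoncentration of binomial variables *)

Section CentralBinomial.
Local Open Scope nat_scope.

(** Raising [i] by one multiplies the right side by [(j + i + 1) / (j - i)], which is at least 1. *)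
Lemma fact_sqr_le i j : i <= j -> j`! ^ 2 <= (j + i)`! * (j - i)`!.
Proof.
elim: i => [_|i IH ij]; first by rewrite addn0 subn0.
apply: leq_trans (IH (ltnW ij)) _.
have -> : j - i = (j - i.+1).+1 by lia.
rewrite addnS !factS mulnCA mulnA leq_pmul2r ?fact_gt0 // leq_pmul2r ?fact_gt0 //.
lia.
Qed.

Lemma bin_le_central j t : 'C(j.*2, t) <= 'C(j.*2, j).
Proof.
have [tj|] := leqP t j.*2; last by move=> /bin_small->.
wlog tj2 : t tj / t <= j => [hw|].
  have [/hw->//|jt] := leqP t j.
  by rewrite -bin_sub //; apply: hw; lia.
rewrite -(@leq_pmul2r (t`! * (j.*2 - t)`!)) ?muln_gt0 ?fact_gt0 // bin_fact //.
have jj : j <= j.*2 by lia.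
rewrite -(bin_fact jj) leq_pmul2l ?bin_gt0 //.
have -> : j.*2 - j = j by lia.
have := @fact_sqr_le (j - t) j (leq_subr _ _).
have -> : j + (j - t) = j.*2 - t by lia.
have -> : j - (j - t) = t by lia.
by rewrite expnS expn1 [t`! * _]mulnC.
Qed.

Lemma central_bin_rec j :
  j.+1 * 'C(j.+1.*2, j.+1) = 2 * (j.*2.+1 * 'C(j.*2, j)).
Proof.
have := mul_bin_down j.*2.+1 j; rewrite (_ : j.*2.+1 - j = j.+1) /=; last lia.
by rewrite doubleS -mul_bin_diag /= => ->; rewrite mulnA; congr (_ * _); lia.
Qed.

(** The central coefficient is at most [4 ^ j] over the square root of [2j + 1]. The induction step
    rests on [(2j + 1)(2j + 3) <= (2j + 2) ^ 2]. *)
Lemma central_bin_sqr_le j : 'C(j.*2, j) ^ 2 * j.*2.+1 <= 16 ^ j.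
Proof.
elim: j => // j IH.
rewrite -(@leq_pmul2l (j.+1 ^ 2)) ?expn_gt0 // mulnA -expnMn central_bin_rec.
rewrite !expnMn [16 ^ _]expnS.
have : j.*2.+1 * j.+1.*2.+1 <= 4 * j.+1 ^ 2 by nia.
move: IH; move: ('C(j.*2, j) ^ 2) (16 ^ j) => X Y; rewrite !expnS !expn0; nia.
Qed.

(** A sum of [2j] fair bits takes each value with probability at most [1 / (2L)], so any [L] given
    values are all avoided with probability at least 1/2. *)
Lemma bin_anticoncentrated L j t :
  (2 * L) ^ 2 <= j.*2.+1 -> 2 * L * 'C(j.*2, t) <= 2 ^ j.*2.
Proof.
move=> Lj; rewrite -leq_sqr expnMn.
apply: leq_trans (leq_mul Lj (_ : _ <= 'C(j.*2, j) ^ 2)) _.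
  by rewrite leq_sqr bin_le_central.
rewrite mulnC; apply: leq_trans (central_bin_sqr_le j) _.
by rewrite -[16]/(2 ^ 4) -!expnM leq_exp2l //; lia.
Qed.

End CentralBinomial.

(** * Resampling edges of the random graph *)

Section RandomGraph.
Variables (R : realType) (n : nat).
Implicit Types (w s : sample n) (x y : 'I_n) (M : rel 'I_n).
Local Notation pr := (@pr R (vpair n)).

(** [M] may be asymmetric: a pair belongs to the set when [M] holds in either order. *)
Definition edge_set M : {set vpair n} :=
  [set e | [exists x, [exists y, (val e == [set x; y]%SET) && M x y]]]%SET.

Lemma sample_adjE x y : x != y ->
  exists2 e : vpair n, val e = [set x; y]%SET & forall w, sample_adj w x y = w e.
Proof.
move=> xy; have c2 : #|[set x; y]%SET| == 2 by rewrite cards2 xy.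
exists (exist _ [set x; y]%SET c2) => // w;
  apply/existsP/idP => [[e /andP[/eqP ve]]|we].
  by rewrite (_ : e = exist _ [set x; y]%SET c2) //; apply: val_inj.
by exists (exist _ [set x; y]%SET c2); rewrite eqxx.
Qed.

Lemma adj_resample M w s x y :
  sample_adj (resample (edge_set M) w s) x y =
  if M x y || M y x then sample_adj s x y else sample_adj w x y.
Proof.
have [<-|xy] := eqVneq x y; first by rewrite !sample_adj_irrefl if_same.
have [e ve eP] := sample_adjE xy; rewrite !eP ffunE inE; congr (if _ then _ else _).
apply/existsP/orP => [[a /existsP[b /andP[]]]|].
  rewrite ve => /eqP /setP ab Mab.
  move: (ab a) (ab b) (ab x) (ab y); rewrite !inE !eqxx !orbT.
  move=> /orP ax /orP bx /esym/orP xa /esym/orP ya.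
  case: xa => /eqP xa; case: ya => /eqP ya; subst; rewrite ?eqxx in xy *;
    rewrite ?Mab; auto.
case=> Mxy; first by exists x; apply/existsP; exists y; rewrite ve eqxx.
by exists y; apply/existsP; exists x; rewrite ve finset.setUC eqxx.
Qed.

Lemma pr_adj x y b : x != y -> pr (fun s => sample_adj s x y == b) = 2^-1.
Proof.
by move=> /sample_adjE[e _ eP]; rewrite -(pr_bit R e b); apply: eq_pr => s;
  rewrite eP.
Qed.

Definition pair_rel (x y : 'I_n) : rel 'I_n := fun a b => (a == x) && (b == y).

Lemma pr_and_adj_le (F : pred (sample n)) x y b : x != y ->
  (forall w s, F (resample (edge_set (pair_rel x y)) w s) = F w) ->
  pr (predI F (fun w => sample_adj w x y == b)) <= 2^-1 * pr F.
Proof.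
move=> xy Finv; apply: (@pr_resample_le _ _ (fun=> edge_set (pair_rel x y))) =>
  // w _.
rewrite -(pr_adj b xy); apply: le_pr => s.
by rewrite adj_resample /pair_rel !eqxx.
Qed.

Lemma pr_and_adj_ge (F : pred (sample n)) x y b : x != y ->
  (forall w s, F (resample (edge_set (pair_rel x y)) w s) = F w) ->
  2^-1 * pr F <= pr (predI F (fun w => sample_adj w x y == b)).
Proof.
move=> xy Finv; apply: (@pr_resample_ge _ _ (fun=> edge_set (pair_rel x y))) =>
  // w _.
rewrite -(pr_adj b xy); apply: le_pr => s.
by rewrite adj_resample /pair_rel !eqxx.
Qed.

(** Pascal's rule, after splitting on the adjacency of [x] to the first vertex of the list. *)
Lemma pr_count_adj_le x (r : seq 'I_n) t : uniq r -> x \notin r ->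
  pr (fun s => count (sample_adj s x) r == t) <= 'C(size r, t)%:R / 2 ^+ size r.
Proof.
elim: r t => [|y r IH] t.
  move=> _ _; rewrite expr0 divr1; case: t => [|t]; first by rewrite bin0 pr_le1.
  by rewrite pr_pred0.
rewrite /= inE negb_or => /andP[yr ur] /andP[xy xr].
have inv k w s : (count (sample_adj (resample (edge_set (pair_rel x y)) w s) x) r
  == k)
    = (count (sample_adj w x) r == k).
  congr (_ == k); apply: eq_in_count => z zr; rewrite adj_resample /pair_rel.
  rewrite (_ : (z == y) = false); last by apply: contraNF yr => /eqP <-.
  by rewrite andbF /= (_ : (z == x) = false) //; apply: contraNF xr => /eqP <-.
have step k b : pr (predI (fun s => count (sample_adj s x) r == k)
     (fun s => sample_adj s x y == b)) <= 'C(size r, k)%:R / 2 ^+ (size r).+1.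
  apply: le_trans (pr_and_adj_le b xy (inv k)) _.
  by rewrite exprS invfM [leRHS]mulrCA ler_pM2l ?invr_gt0 // IH.
case: t => [|t].
  have := step 0%N false; rewrite !bin0; apply: le_trans; apply: le_pr => s /=.
  by case: (sample_adj s x y) => //=; rewrite add0n => ->.
rewrite binS natrD mulrDl addrC.
apply: le_trans (lerD (step t true) (step t.+1 false)).
apply: le_trans (prU _ _ _); apply: le_pr => s /=.
by case: (sample_adj s x y) => /=;
  rewrite ?add1n ?add0n ?andbT ?andbF ?orbF // eqSS => ->.
Qed.

End RandomGraph.

(** * Neighbour degrees separate vertices *)

Section SameNbrDeg.
Variables (R : realType) (n : nat).
Implicit Types (w s : sample n) (x y : 'I_n).
Local Notation pr := (@pr R (vpair n)).

(** For each of the [n - 2] other vertices [c], once [vc] is known the single pair [uc] decides the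
    event. *)
Lemma pr_no_balanced_vertex (u v : 'I_n) : u != v ->
  pr [pred w | [forall c, (c \notin [:: u; v]) ==>
                          (sample_adj w u c != sample_adj w v c)]]
  <= 2^-1 ^+ (n - 2).
Proof.
move=> uv; pose r := [seq c <- enum 'I_n | c \notin [:: u; v]].
have szr : size r = (n - 2)%N.
  have := count_predC (mem [:: u; v]) (enum 'I_n).
  rewrite size_enum_ord -size_filter; set k := size _ => kn.
  have <- : k = 2%N.
    rewrite -[2%N]/(size [:: u; v]); apply/perm_size/uniq_perm.
    - exact/filter_uniq/enum_uniq.
    - by rewrite /= inE uv.
    - by move=> x; rewrite mem_filter mem_enum andbT.
  by rewrite -[in RHS]kn addKn size_filter.
rewrite -szr.
pose F c w := sample_adj w u c != sample_adj w v c.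
apply: le_trans (@pr_all_le R _ _ r (fun c => edge_set (pair_rel u c)) F 2^-1 _ _
  _ _).
- apply: le_pr => w /forallP wP; apply/allP => c.
  by rewrite mem_filter => /andP[cuv _]; apply: (implyP (wP c)).
- exact/filter_uniq/enum_uniq.
- by rewrite invr_ge0.
- move=> c; rewrite mem_filter => /andP[cuv _] w.
  have uc : u != c by apply: contraNneq cuv => ->; rewrite inE eqxx.
  rewrite -(pr_adj R (~~ sample_adj w v c) uc); apply: le_pr => s.
  rewrite /F !adj_resample /pair_rel !eqxx /= [v == u]eq_sym (negbTE uv) /=.
  rewrite [c == u]eq_sym (negbTE uc) /=.
  by case: (sample_adj s u c); case: (sample_adj w v c).
- move=> c c'; rewrite !mem_filter => /andP[cuv _] /andP[c'uv _] cc' w s.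
  rewrite /F !adj_resample /pair_rel (negbTE cc') andbF /= [v == u]eq_sym (negbTE
    uv) /=.
  by move: cuv; rewrite !inE negb_or => /andP[/negbTE-> _].
Qed.

Section Triple.
Variables u v c0 : 'I_n.
Hypotheses (uv : u != v) (c0u : c0 != u) (c0v : c0 != v).

Definition gdeg w (a : 'I_n) : nat := #|[pred x | (x != c0) && sample_adj w a x]|.

Definition private_nbrs w : {set 'I_n} :=
  [set a | [&& a \notin [:: u; v; c0], sample_adj w u a & ~~ sample_adj w v a]]%SET.

(** One private neighbour for each value of [gdeg], that of least index. The choice depends only on
    pairs avoiding [c0], so resampling edges at [c0] does not alter it. *)
Definition reps w : {set 'I_n} :=
  [set a in private_nbrs w |
    [forall b in private_nbrs w, (gdeg w b == gdeg w a) ==> (a <= b)%N]]%SET.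

Lemma deg_gdeg w a : @deg (sample_graph w) a = (gdeg w a + sample_adj w a c0)%N.
Proof.
by rewrite /deg (cardD1 c0) addnC; congr (_ + _)%N; apply: eq_card => x.
Qed.

Lemma gdeg_le w a : (gdeg w a <= n)%N.
Proof. by rewrite -[X in (_ <= X)%N](card_ord n) max_card. Qed.

Lemma ex_rep w a : a \in private_nbrs w ->
  exists2 b, b \in reps w & gdeg w b = gdeg w a.
Proof.
move=> aA.
pose P b := (b \in private_nbrs w) && (gdeg w b == gdeg w a).
have Pa : P a by rewrite /P aA eqxx.
case: (arg_minnP (fun b : 'I_n => b : nat) Pa) => b /andP[bA /eqP gb] bmin.
exists b => //; rewrite inE bA; apply/forall_inP => c cA; apply/implyP => /eqP gc.
by apply: bmin; rewrite /P cA gc gb eqxx.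
Qed.

Lemma rep_inj w : {in reps w &, injective (gdeg w)}.
Proof.
move=> a b; rewrite [a \in _]inE [b \in _]inE.
move=> /andP[aA /forall_inP am] /andP[bA /forall_inP bm] ab.
apply/val_inj/eqP; rewrite eqn_leq (implyP (am b bA)) ?ab //.
by rewrite (implyP (bm a aA)) ?ab.
Qed.

Definition rep_edges w := edge_set (fun x y => (x \in reps w) && (y == c0)).

Lemma reps_private w a : a \in reps w ->
  [/\ a != u, a != v, a != c0, sample_adj w u a & ~~ sample_adj w v a].
Proof.
by rewrite !inE => /andP[/and3P[]]; rewrite !negb_or => /and3P[-> -> ->] -> ->.
Qed.

Lemma not_rep w : (u \in reps w = false) * (v \in reps w = false) * (c0 \in reps
  w = false).
Proof.
by split; first split; apply/negbTE/negP => /reps_private[]; rewrite eqxx.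
Qed.

Lemma adj_uv_resample w s x y : x \in [:: u; v] ->
  sample_adj (resample (rep_edges w) w s) x y = sample_adj w x y.
Proof.
rewrite !inE => /orP[]/eqP->; rewrite adj_resample not_rep /=.
  by rewrite [u == c0]eq_sym (negbTE c0u) andbF.
by rewrite [v == c0]eq_sym (negbTE c0v) andbF.
Qed.

Lemma adj_nonrep_resample w s x y : x != c0 -> y != c0 ->
  sample_adj (resample (rep_edges w) w s) x y = sample_adj w x y.
Proof. by move=> /negbTE x0 /negbTE y0; rewrite adj_resample x0 y0 !andbF. Qed.

Lemma gdeg_resample w s a : a != c0 ->
  gdeg (resample (rep_edges w) w s) a = gdeg w a.
Proof.
move=> a0; apply: eq_card => x; rewrite !inE.
by case: (eqVneq x c0) => //= x0; rewrite adj_nonrep_resample.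
Qed.

Lemma reps_resample w s : reps (resample (rep_edges w) w s) = reps w.
Proof.
have AE : private_nbrs (resample (rep_edges w) w s) = private_nbrs w.
  by apply/setP => a; rewrite !inE !adj_uv_resample // !inE eqxx ?orbT.
apply/setP => a; rewrite inE AE [RHS]inE.
case aA : (a \in private_nbrs w) => //=.
have A0 b : b \in private_nbrs w -> b != c0.
  by rewrite !inE !negb_or => /andP[/and3P[]].
apply: eq_forallb_in => b bA; by rewrite !gdeg_resample ?A0.
Qed.

(* Subtracting the two equations, every vertex cancels except the private
   neighbour of least degree on which the two samples differ. *)
Lemma same_nbr_deg_resample_inj w s1 s2 :
  sample_adj w u c0 = sample_adj w v c0 ->
  @same_nbr_deg (sample_graph (resample (rep_edges w) w s1)) u v ->
  @same_nbr_deg (sample_graph (resample (rep_edges w) w s2)) u v ->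
  {in reps w, forall a, sample_adj s1 a c0 = sample_adj s2 a c0}.
Proof.
move=> bal same1 same2 a ra; apply: contrapT => /eqP da.
pose P a := (a \in reps w) && (sample_adj s1 a c0 != sample_adj s2 a c0).
have Pa : P a by rewrite /P ra.
case: (arg_minnP (gdeg w) Pa) => {ra da Pa}a /andP[ra da] amin.
pose G s := sample_graph (resample (rep_edges w) w s).
pose d := gdeg w a.
pose z (b : bool) : int := (b : nat)%:Z.
pose T s y : int := (z (sample_adj w u y) - z (sample_adj w v y))
   * z (@deg (G s) y == d).
have sumT s : @same_nbr_deg (G s) u v -> \sum_y T s y = 0.
  have dn : (d < #|G s|.+1)%N by rewrite card_ord ltnS gdeg_le.
  move=> /forallP/(_ (Ordinal dn))/eqP/= nd.
  have nbrE x : x \in [:: u; v] -> (@nbr_deg (G s) x d)%:Z =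
      \sum_y z (sample_adj w x y) * z (@deg (G s) y == d).
    move=> xuv; rewrite /nbr_deg -sum1_card big_mkcond /= -natz natr_sum.
    apply: eq_bigr => y _; rewrite !inE /= adj_uv_resample //.
    by rewrite /z; case: (sample_adj w x y); case: (_ == d).
  rewrite /T (eq_bigr (fun y => z (sample_adj w u y) * z (@deg (G s) y == d)
    - z (sample_adj w v y) * z (@deg (G s) y == d))); last by move=> y _;
        rewrite mulrBl.
  by rewrite sumrB -!nbrE ?inE ?eqxx ?orbT // nd subrr.
have degrep s y : y \in reps w -> @deg (G s) y = (gdeg w y + sample_adj s y c0)%N.
  move=> ry; have [_ _ y0 _ _] := reps_private ry.
  rewrite deg_gdeg gdeg_resample //.
  by rewrite adj_resample ry eqxx.
have : \sum_y (T s1 y - T s2 y) = 0 by rewrite sumrB (sumT s1) // (sumT s2) //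
  subrr.
rewrite (bigD1 a) //= big1 ?addr0 => [|y ya].
  (* At [a] the degree equals [d] in exactly one of the two samples, and [a] is adjacent to [u] but
     not to [v], so the two terms differ by 1. *)
  have [_ _ _ ua va] := reps_private ra.
  rewrite /T !degrep // ua (negbTE va) /d.
  by move: da; case: (sample_adj s1 a c0); case: (sample_adj s2 a c0) => //= _;
     rewrite ?addn0 ?addn1 ?eqxx ?(gtn_eqF (ltnSn _)).
have [ry|nry] := boolP (y \in reps w); last first.
  have [->|y0] := eqVneq y c0; first by rewrite /T bal subrr !mul0r subrr.
  have -> : T s1 y = T s2 y; last by rewrite subrr.
  rewrite /T; congr (_ * z (_ == d)); apply: eq_card => x; rewrite !inE /=.
  by rewrite !adj_resample (negbTE nry) (negbTE y0) andbF.
have [eqs|nes] := eqVneq (sample_adj s1 y c0) (sample_adj s2 y c0).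
  by rewrite /T !degrep // eqs subrr.
(* By minimality and distinctness of the values, [y] has degree above [d] in both samples. *)
have : (d < gdeg w y)%N.
  rewrite ltn_neqAle amin /P ?ry // andbT; apply: contraNneq ya => dy.
  by apply/eqP; apply: (@rep_inj w).
by move=> lt; rewrite /T !degrep // !gtn_eqF ?ltn_addr // mulr0 subrr.
Qed.

(** Only the edges from the representatives to [c0] are resampled. If some outcome [s0] gives equal
    colours, every other such outcome agrees with [s0] on all these edges, of which there are at
    least [L]. *)
Lemma pr_same_nbr_deg_reps L :
  pr [pred w | [&& sample_adj w u c0 == sample_adj w v c0, (L <= #|reps w|)%N
                 & @same_nbr_deg (sample_graph w) u v]] <= 2^-1 ^+ L.
Proof.
pose F w := (sample_adj w u c0 == sample_adj w v c0) && (L <= #|reps w|)%N.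
rewrite (@eq_pr _ _ _ (predI F (fun w => @same_nbr_deg (sample_graph w) u v)));
  last first.
  by move=> w; rewrite /= /F -andbA.
apply: le_trans (@pr_resample_le _ _ rep_edges (2^-1 ^+ L) _ _ _ _ _) _.
- by move=> w s; rewrite /rep_edges reps_resample.
- by move=> w s; rewrite /F reps_resample !adj_uv_resample // !inE eqxx ?orbT.
- move=> w /andP[/eqP bal Lw].
  have [[s0 s0P]|no] := pselect (exists s0, @same_nbr_deg (sample_graph (resample
    (rep_edges w) w s0)) u v); last first.
    rewrite pr_pred0 ?exprn_ge0 ?invr_ge0 // => s; apply/negP => ss; apply: no.
    by exists s.
  have r0 : 0 <= 2^-1 :> R by lra.
  have r1 : 2^-1 <= 1 :> R by lra.
  apply: (@le_trans _ _ (2^-1 ^+ #|reps w|)); last exact: ler_wiXn2l.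
  rewrite cardE.
  pose E a s := sample_adj s a c0 == sample_adj s0 a c0.
  apply: le_trans (@pr_all_le R _ _ (enum (reps w)) (fun a => edge_set (pair_rel
    a c0)) E _ (enum_uniq _) r0 _ _).
  + apply: le_pr => s sP; apply/allP => a; rewrite mem_enum => ra; apply/eqP.
    exact: (@same_nbr_deg_resample_inj w).
  + move=> a; rewrite mem_enum => /reps_private[_ _ a0 _ _] w'.
    rewrite -(pr_adj R (sample_adj s0 a c0) a0); apply: le_pr => s.
    by rewrite /E adj_resample /pair_rel !eqxx.
  + move=> a b; rewrite !mem_enum => /reps_private[_ _ a0 _ _] _ ab w' s.
    by rewrite /E adj_resample /pair_rel (negbTE ab) (negbTE a0) !andbF.
- by rewrite ler_piMr ?pr_le1 // exprn_ge0 // invr_ge0.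
Qed.

Definition rest := [seq x <- enum 'I_n | x \notin [:: u; v; c0]].

Let uniq3 : uniq [:: u; v; c0].
Proof. by rewrite /= !inE negb_or uv [u == _]eq_sym [v == _]eq_sym c0u c0v. Qed.

Lemma perm_rest : perm_eq (enum 'I_n) ([:: u; v; c0] ++ rest).
Proof.
apply: uniq_perm; first exact: enum_uniq.
  rewrite cat_uniq uniq3 filter_uniq ?enum_uniq // andbT.
  by apply/hasPn => x; rewrite mem_filter => /andP[].
by move=> x; rewrite mem_cat mem_enum mem_filter mem_enum andbT orbN.
Qed.

Lemma size_rest : size rest = (n - 3)%N.
Proof.
have /perm_size := perm_rest; rewrite size_enum_ord size_cat /=; lia.
Qed.

Lemma gdegE w a : gdeg w a =
  (sample_adj w a u + sample_adj w a v + count (sample_adj w a) rest)%N.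
Proof.
have -> : gdeg w a = count (fun x => (x != c0) && sample_adj w a x) (enum 'I_n).
  by rewrite /gdeg cardE size_filter enumT; apply: eq_count.
rewrite (seq.permP perm_rest) count_cat /= eqxx /=.
rewrite [u == _]eq_sym [v == _]eq_sym c0u c0v /= !addn0; congr (_ + _)%N.
apply: eq_in_count => x; rewrite mem_filter !inE !negb_or.
by move=> /andP[/and3P[_ _ ->]].
Qed.

Section FewReps.
Variables (L j : nat) (t : {ffun 'I_L -> 'I_n.+1}).
Hypotheses (Lj : ((2 * L) ^ 2 <= j.*2.+1)%N) (jn : (j.*2 <= n - 3)%N).

(** Each vertex of [V1] gets its own block of random pairs, those to [u], [v] and the [2j] vertices
    of [V2]. Blocks of different vertices of [V1] are disjoint. *)
Let V2 := take j.*2 rest.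
Let V1 := drop j.*2 rest.

Let uniq_V12 : uniq (V2 ++ V1).
Proof. by rewrite cat_take_drop filter_uniq ?enum_uniq. Qed.

Let V12_rest x : x \in V2 ++ V1 -> [/\ x != u, x != v & x != c0].
Proof.
by rewrite cat_take_drop mem_filter !inE !negb_or => /andP[/and3P[]].
Qed.

Definition block_rel (a : 'I_n) : rel 'I_n :=
  fun x y => (x == a) && ((y \in [:: u; v]) || (y \in V2)).

Definition in_values w a := [exists i, t i == gdeg w a :> nat].

Definition escapes w a :=
  [&& sample_adj w a u, ~~ sample_adj w a v & ~~ in_values w a].

Lemma pr_count_in_values a h : a \notin V2 ->
  pr (fun s => [exists i, t i == h + count (sample_adj s a) V2 :> nat]%N) <= 2^-1.
Proof.
move=> aV2; apply: le_trans (pr_exists _ _) _.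
have szV2 : size V2 = j.*2 by rewrite size_takel // size_rest.
have uV2 : uniq V2 by move: uniq_V12; rewrite cat_uniq => /and3P[].
have bound (i : 'I_L) : true -> pr (fun s => t i == h + count (sample_adj s a) V2
  :> nat)%N
    <= (2 * L)%:R^-1.
  (* Truncated subtraction is harmless: for [t i < h] the event on the left is empty. *)
  move=> _; apply: le_trans (_ : pr (fun s => count (sample_adj s a) V2 == (t i -
    h)%N) <= _).
    by apply: le_pr => s /eqP ->; rewrite addKn.
  apply: le_trans (pr_count_adj_le _ _ uV2 aV2) _.
  have L0 : (0 < 2 * L)%N by case: i; case: (L).
  rewrite szV2 ler_pdivrMr ?exprn_gt0 // mulrC ler_pdivlMr ?ltr0n //.
  rewrite -natrX -natrM ler_nat mulnC; exact: bin_anticoncentrated.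
apply: le_trans (ler_sum _ bound) _.
rewrite sumr_const card_ord -[leLHS]mulr_natl.
case: (L) => [|l]; first by rewrite mul0r invr_ge0.
by rewrite ler_pdivrMr ?ltr0n // natrM mulrA mulVf ?mul1r ?pnatr_eq0.
Qed.

(** Three factors 1/2: the pair [au] is an edge, the pair [av] is not, and the count in [V2] avoids
    the listed values. *)
Lemma pr_escapes_resample w a : a \in V1 ->
  8^-1 <= pr (fun s => escapes (resample (edge_set (block_rel a)) w s) a).
Proof.
move=> aV1.
have [au av ac] : [/\ a != u, a != v & a != c0].
  by apply: V12_rest; rewrite mem_cat aV1 orbT.
have aV2 : a \notin V2.
  by move: uniq_V12; rewrite cat_uniq => /and3P[_ /hasPn h _]; apply: h.
(* The part of [gdeg] outside [V2] when [a] escapes: 1 for [u], 0 for [v], and the neighbours in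
   [V1], which stay fixed. *)
pose h := (1 + count (sample_adj w a) V1)%N.
pose K s := ~~ [exists i, t i == h + count (sample_adj s a) V2 :> nat]%N.
have Kinv x : x \notin V2 -> forall w s,
    K (resample (edge_set (pair_rel a x)) w s) = K w.
  move=> xV2 w' s; rewrite /K; congr (~~ _); apply: eq_existsb => i.
  congr (_ == _ + _)%N; apply: eq_in_count => y yV2; rewrite adj_resample /pair_rel.
  have -> : (y == x) = false by apply: contraNF xV2 => /eqP <-.
  have -> : (y == a) = false by apply: contraNF aV2 => /eqP <-.
  by rewrite andbF.
have uV2 : u \notin V2.
  by apply/negP => uV; have [] := @V12_rest u; rewrite ?mem_cat ?uV ?eqxx.
have vV2 : v \notin V2.
  by apply/negP => vV; have [] := @V12_rest v; rewrite ?mem_cat ?vV ?eqxx.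
have K2 : 2^-1 <= pr K.
  have -> : pr K = 1 - pr (predC K) by rewrite -prC; apply: eq_pr => s /=;
    rewrite negbK.
  rewrite lerBrDl -lerBrDr; apply: le_trans (_ : 2^-1 <= _); last by lra.
  apply: le_trans (pr_count_in_values h aV2).
  by apply: le_pr => s /=; rewrite negbK.
have K4 := @pr_and_adj_ge R n K a u true au (Kinv u uV2).
have K8 := @pr_and_adj_ge R n (predI K (fun s => sample_adj s a u == true)) a v
  false av.
apply: (@le_trans _ _ (pr (predI (predI K (fun s => sample_adj s a u == true))
  (fun s => sample_adj s a v == false)))).
  apply: le_trans (K8 _); last first.
    move=> w' s /=; rewrite Kinv // adj_resample /pair_rel (negbTE uv) andbF /=.
    by rewrite [u == a]eq_sym (negbTE au).
  lra.
apply: le_pr => s /= /andP[/andP[Ks /eqP su] /eqP sv].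
rewrite /escapes /in_values !gdegE !adj_resample /block_rel !eqxx !inE !eqxx
  !orbT /= su sv /=.
rewrite addn0 -[rest](cat_take_drop j.*2) count_cat -/V1 -/V2.
rewrite (@eq_in_count _ _ (sample_adj s a) V2); last first.
  by move=> x xV2; rewrite adj_resample eqxx xV2 !orbT.
rewrite (@eq_in_count _ _ (sample_adj w a) V1); last first.
  move=> x xV1; rewrite adj_resample eqxx /=.
  have [xu xv xc] : [/\ x != u, x != v & x != c0].
    by apply: V12_rest; rewrite mem_cat xV1 orbT.
  have xV2 : x \notin V2.
    by move: uniq_V12; rewrite cat_uniq => /and3P[_ /hasPn hh _]; apply: hh.
  by rewrite !inE (negbTE xu) (negbTE xv) (negbTE xV2) (negbTE au) (negbTE av)
    (negbTE aV2) andbF.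
by rewrite [X in (1 + X)%N]addnC addnA.
Qed.

Lemma pr_no_escape :
  pr [pred w | [forall a in private_nbrs w, in_values w a]]
  <= (7 / 8) ^+ (n - 3 - j.*2).
Proof.
have -> : (n - 3 - j.*2)%N = size V1 by rewrite size_drop size_rest.
apply: le_trans (@pr_all_le R _ _ V1 (fun a => edge_set (block_rel a))
   (fun a w => ~~ escapes w a) (7 / 8) _ _ _ _).
- apply: le_pr => w /forall_inP wP; apply/allP => a aV1; apply/negP.
  case/and3P=> au av; rewrite wP // !inE !negb_or ![sample_adj w _
    a]sample_adj_sym au av.
  by have [|-> -> ->] := @V12_rest a; rewrite // mem_cat aV1 orbT.
- by move: uniq_V12; rewrite cat_uniq => /and3P[].
- lra.
- move=> a aV1 w; have := pr_escapes_resample w aV1.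
  rewrite -[X in X <= _ -> _]/(8^-1).
  have := prC R (fun s => escapes (resample (edge_set (block_rel a)) w s) a).
  by rewrite -[pr (fun s => ~~ _)]/(pr (predC _)) => ->; lra.
- move=> a b aV1 bV1 ab w s; congr (~~ _).
  have [bu bv _] : [/\ b != u, b != v & b != c0].
    by apply: V12_rest; rewrite mem_cat bV1 orbT.
  have [au av _] : [/\ a != u, a != v & a != c0].
    by apply: V12_rest; rewrite mem_cat aV1 orbT.
  have aV2 : a \notin V2.
    by move: uniq_V12; rewrite cat_uniq => /and3P[_ /hasPn hh _]; apply: hh.
  have adjE x : sample_adj (resample (edge_set (block_rel b)) w s) a x =
    sample_adj w a x.
    by rewrite adj_resample /block_rel (negbTE ab) /= !inE (negbTE au) (negbTE
      av) (negbTE aV2) andbF.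
  rewrite /escapes /in_values !adjE; congr [&& _, _ & ~~ _].
  apply: eq_existsb => i; congr (_ == _); apply: eq_card => x.
  by rewrite !inE adjE.
Qed.

End FewReps.

Lemma pr_few_reps L j : ((2 * L) ^ 2 <= j.*2.+1)%N -> (j.*2 <= n - 3)%N ->
  pr [pred w | (#|reps w| <= L)%N]
  <= (n.+1 ^ L)%:R * (7 / 8) ^+ (n - 3 - j.*2).
Proof.
move=> Lj jn.
apply: (@le_trans _ _ (pr [pred w | [exists t : {ffun 'I_L -> 'I_n.+1},
    [forall a in private_nbrs w, in_values t w a]]])).
  apply: le_pr => w rL; apply/existsP.
  exists [ffun i : 'I_L => inord (nth 0%N [seq gdeg w a | a <- enum (reps w)] i)].
  apply/forall_inP => a /ex_rep[b rb gb].
  have bi : (index b (enum (reps w)) < L)%N.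
    by apply: leq_trans rL; rewrite cardE index_mem mem_enum.
  apply/existsP; exists (Ordinal bi);
    rewrite ffunE /= (nth_map b) ?index_mem ?mem_enum //.
  by rewrite nth_index ?mem_enum // gb inordK // ltnS gdeg_le.
apply: le_trans (pr_exists _ _) _.
apply: le_trans (ler_sum _ (fun t _ => pr_no_escape t Lj jn)) _.
by rewrite sumr_const card_ffun !card_ord -[leLHS]mulr_natl.
Qed.

End Triple.

(** Either no vertex is balanced between [u] and [v], or a balanced [c] has few representatives, or
    it has many and the colours still coincide. The last two cases are summed over [c]. *)
Lemma pr_same_nbr_deg (u v : 'I_n) L j : u != v ->
  ((2 * L) ^ 2 <= j.*2.+1)%N -> (j.*2 <= n - 3)%N ->
  pr (fun w => @same_nbr_deg (sample_graph w) u v)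
  <= 2^-1 ^+ (n - 2)
     + n%:R * ((n.+1 ^ L)%:R * (7 / 8) ^+ (n - 3 - j.*2) + 2^-1 ^+ L).
Proof.
move=> uv Lj jn.
pose B c w := (c \notin [:: u; v]) &&
  ((#|reps u v c w| <= L)%N || [&& sample_adj w u c == sample_adj w v c,
      (L <= #|reps u v c w|)%N & @same_nbr_deg (sample_graph w) u v]).
apply: (@le_trans _ _ (pr (predU [pred w | [forall c, (c \notin [:: u; v]) ==>
     (sample_adj w u c != sample_adj w v c)]] [pred w | [exists c, B c w]]))).
  apply: le_pr => w wP; apply/orP.
  have [|] := boolP [forall c, (c \notin [:: u;
    v]) ==> (sample_adj w u c != sample_adj w v c)]; first by left.
  rewrite negb_forall => /existsP[c]; rewrite negb_imply negbK => /andP[cuv bal].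
  right; apply/existsP; exists c; rewrite /B cuv bal wP andbT /=; lia.
apply: le_trans (prU _ _ _) _; apply: lerD; first exact: pr_no_balanced_vertex.
apply: le_trans (pr_exists _ _) _.
have bound (c : 'I_n) : true -> pr (B c) <= (n.+1 ^ L)%:R * (7 / 8) ^+ (n - 3 -
  j.*2) + 2^-1 ^+ L.
  move=> _; case cuv: (c \notin [:: u; v]); last first.
    rewrite pr_pred0; last by move=> w; rewrite /B cuv.
    by rewrite addr_ge0 ?mulr_ge0 ?exprn_ge0 ?invr_ge0 //.
  move: (cuv); rewrite !inE negb_or => /andP[cu cv].
  apply: le_trans (lerD (pr_few_reps uv cu cv Lj jn) (pr_same_nbr_deg_reps cu cv
    L)).
  apply: le_trans (prU _ _ _); apply: le_pr => w; by rewrite /B cuv.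
apply: le_trans (ler_sum _ bound) _.
by rewrite sumr_const card_ord -[leLHS]mulr_natl.
Qed.

End SameNbrDeg.

(** * Disjoint pairs of vertices of equal degree *)

Section EqualPairs.
Local Open Scope nat_scope.

(** Pigeonhole: while fewer than [lo] vertices are used, more vertices remain than the [#|V| - lo]
    possible values. *)
Lemma disjoint_equal_pairs (V : finType) (f : V -> nat) (lo k : nat) :
  0 < #|V| -> (forall v, lo <= f v < #|V|) -> k.*2 <= lo ->
  exists s : seq V, [/\ size s = k.*2, uniq s
    & forall x0 i, i < k -> f (nth x0 s i.*2) = f (nth x0 s i.*2.+1)].
Proof.
move=> V0 flo; have loV : lo < #|V|.
  by have /card_gt0P[v _] := V0; have /andP[] := flo v; apply: leq_ltn_trans.
elim: k => [_|k IH klo]; first by exists [::].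
have [|s [sz us sP]] := IH; first by lia.
have : ~~ dinjectiveb f [pred v | v \notin s].
  apply/negP => /uniq_leq_size h; move: (h (iota lo (#|V| - lo))).
  rewrite size_map -cardE size_iota.
  have -> : #|[pred v | v \notin s]| = #|V| - k.*2.
    by rewrite -(cardC (mem s)) (card_uniqP us) sz addKn; apply: eq_card => v.
  move=> {}h; have : #|V| - k.*2 <= #|V| - lo; last by lia.
  apply: h => _ /mapP[v _ ->]; rewrite mem_iota; have := flo v; lia.
case/dinjectivePn => x; rewrite inE => xs [y]; rewrite !inE => /andP[yx ys] fxy.
exists [:: x, y & s]; split=> /=.
- by rewrite sz.
- by rewrite inE negb_or eq_sym yx xs ys us.
- by move=> x0 [_|i] //= ik; apply: sP.
Qed.

Lemma deg_lt_card (G : sgraph) (x : G) : deg x < #|G|.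
Proof.
rewrite /deg -(cardC [pred y | adj x y]) -addn1 leq_add2l; apply/card_gt0P.
by exists x; rewrite !inE /= adj_irrefl.
Qed.
End EqualPairs.

(** * Random graphs are switchable *)

Section Switchable.
Variables (R : realType) (n : nat).
Implicit Types (w s : sample n) (x y : 'I_n).
Local Notation pr := (@pr R (vpair n)).

(** Union bound over maps [z] whose image covers the neighbourhood of [v]; at least [n - lo - 1]
    vertices outside the image and other than [v] are then non-adjacent to [v]. *)
Lemma pr_low_degree (v : 'I_n) lo :
  pr [pred w | (@deg (sample_graph w) v <= lo)%N]
  <= (n ^ lo)%:R * 2^-1 ^+ (n - lo.+1).
Proof.
apply: (@le_trans _ _ (pr [pred w | [exists z : {ffun 'I_lo -> 'I_n},
    [forall c, sample_adj w v c ==> (c \in codom z)]]])).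
  apply: le_pr => w /= dv; apply/existsP.
  exists [ffun i : 'I_lo => nth v (enum [pred y | sample_adj w v y]) i].
  apply/forallP => c; apply/implyP => vc.
  have cN : c \in enum [pred y | sample_adj w v y] by rewrite mem_enum.
  have ci : (index c (enum [pred y | sample_adj w v y]) < lo)%N.
    by apply: leq_trans dv; rewrite /deg cardE index_mem.
  by apply/codomP; exists (Ordinal ci); rewrite ffunE /= nth_index.
apply: le_trans (pr_exists _ _) _.
have r0 : 0 <= 2^-1 :> R by lra.
have r1 : 2^-1 <= 1 :> R by lra.
have bound (z : {ffun 'I_lo -> 'I_n}) : true ->
    pr (fun w => [forall c, sample_adj w v c ==> (c \in codom z)])
    <= 2^-1 ^+ (n - lo.+1).
  move=> _; pose r := [seq c <- enum 'I_n | c \notin v :: codom z].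
  apply: (@le_trans _ _ (2^-1 ^+ size r)).
    apply: le_trans (@pr_all_le R _ _ r (fun c => edge_set (pair_rel v c))
       (fun c w => sample_adj w v c == false) _ _ r0 _ _).
    - apply: le_pr => w /forallP wP; apply/allP => c;
        rewrite mem_filter inE negb_or.
      by move=> /andP[/andP[_ cz] _]; have := wP c;
        rewrite (negbTE cz) implybF => /negbTE->.
    - exact/filter_uniq/enum_uniq.
    - move=> c; rewrite mem_filter inE negb_or => /andP[/andP[cv _] _] w.
      rewrite eq_sym in cv; rewrite -(pr_adj R false cv); apply: le_pr => s.
      by rewrite adj_resample /pair_rel !eqxx.
    - move=> c c'; rewrite !mem_filter !inE !negb_or => /andP[/andP[cv _] _] _
        cc' w s.
      by rewrite adj_resample /pair_rel (negbTE cc') (negbTE cv) andbF.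
  apply: ler_wiXn2l => //.
  have := count_predC (mem (v :: codom z)) (enum 'I_n).
  rewrite size_enum_ord -!size_filter -[X in (_ + X)%N]/(size r).
  set r' := [seq x <- _ | _] => szr.
  have : (size r' <= size (v :: codom z))%N.
    apply: uniq_leq_size; first exact/filter_uniq/enum_uniq.
    by move=> x; rewrite mem_filter => /andP[].
  by rewrite /= size_codom card_ord leq_subLR -[X in _ -> (X <= _)%N]szr leq_add2r.
apply: le_trans (ler_sum _ bound) _.
by rewrite sumr_const card_ffun !card_ord -[leLHS]mulr_natl.
Qed.

Definition alternating w (a b c d : 'I_n) :=
  [&& sample_adj w a b, sample_adj w d c, ~~ sample_adj w a c & ~~ sample_adj w d
    b].

Lemma pr_alternating a b c d : uniq [:: a; b; c; d] ->
  16^-1 <= pr (fun w => alternating w a b c d).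
Proof.
rewrite /= !inE !negb_or andbT => /and3P[/and3P[ab ac ad] /andP[bc bd] cd].
have [ba ca da] : [/\ b != a, c != a & d != a] by rewrite ![_ == a]eq_sym.
have [cb db dc] : [/\ c != b, d != b & d != c] by rewrite ![_ == b]eq_sym [d ==
  c]eq_sym.
have h1 := pr_adj R true ab.
have h2 := @pr_and_adj_ge R n (fun w => sample_adj w a b == true) d c true dc.
have h3 := @pr_and_adj_ge R n (predI (fun w => sample_adj w a b == true)
  (fun w => sample_adj w d c == true)) a c false ac.
have h4 := @pr_and_adj_ge R n (predI (predI (fun w => sample_adj w a b == true)
  (fun w => sample_adj w d c == true)) (fun w => sample_adj w a c == false)) d b
    false db.
apply: le_trans (le_trans (h4 _) _).
- apply: le_trans (_ : 2^-1 * (2^-1 * (2^-1 * 2^-1)) <= _); first by lra.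
  rewrite ler_pM2l ?invr_gt0 //; apply: le_trans (h3 _).
    rewrite ler_pM2l ?invr_gt0 // -{2}h1; apply: h2 => w s.
    by rewrite adj_resample /pair_rel (negbTE ad) (negbTE bd) /=.
  move=> w s /=; rewrite !adj_resample /pair_rel !eqxx.
  by rewrite (negbTE bc) (negbTE da) (negbTE ba) (negbTE ca).
- move=> w s /=; rewrite !adj_resample /pair_rel !eqxx.
  by rewrite (negbTE ad) (negbTE bd) (negbTE cb) (negbTE cd) (negbTE ab).
- by apply: le_pr => w /= /andP[/andP[/andP[/eqP e1 /eqP e2] /eqP e3] /eqP e4];
    rewrite /alternating e1 e2 e3 e4.
Qed.

Section Grid.
Variable m : nat.
Implicit Type p : {ffun bool * 'I_m * bool -> 'I_n}.

(** [p (b, i, c)] is the vertex [c] of the [i]-th pair in family [b]. A cell [ij] of the grid joins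
    pair [i] of one family to pair [j] of the other, and distinct cells use disjoint sets of
    edges. *)
Definition grid_alternating p w (ij : 'I_m * 'I_m) :=
  alternating w (p (false, ij.1, false)) (p (true, ij.2, false))
                (p (true, ij.2, true)) (p (false, ij.1, true)).

Definition grid_rel p (ij : 'I_m * 'I_m) : rel 'I_n := fun x y =>
  (x \in [:: p (false, ij.1, false); p (false, ij.1, true)])
  && (y \in [:: p (true, ij.2, false); p (true, ij.2, true)]).

Lemma pr_no_grid_alternating p : injective p ->
  pr (fun w => [forall ij, ~~ grid_alternating p w ij]) <= (15 / 16) ^+ (m ^ 2).
Proof.
move=> pinj.
have -> : (m ^ 2)%N = size (enum {: 'I_m * 'I_m}).
  by rewrite -cardE card_prod !card_ord.
apply: le_trans (@pr_all_le R _ _ (enum {: 'I_m * 'I_m})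
   (fun ij => edge_set (grid_rel p ij)) (fun ij w => ~~ grid_alternating p w ij)
   (15 / 16) (enum_uniq _) _ _ _).
- by apply: le_pr => w /forallP wP; apply/allP => ij _; apply: wP.
- lra.
- move=> [i j] _ w.
  have u4 : uniq [:: p (false, i, false); p (true, j, false); p (true, j, true);
    p (false, i, true)].
    by rewrite /= !inE !(inj_eq pinj) !xpair_eqE /= !andbF.
  have h := pr_alternating u4.
  apply: le_trans (_ : pr (predC (fun w => alternating w (p (false, i, false)) (p
    (true, j, false)) (p (true, j, true)) (p (false, i, true)))) <= _).
    apply: le_pr => s /=; apply: contra.
    by rewrite /grid_alternating /alternating !adj_resample /grid_rel /= !inE
      !eqxx !orbT.
  by rewrite prC; lra.
- move=> [i j] [i' j'] _ _ neq w s.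
  congr (~~ _); rewrite /grid_alternating /alternating !adj_resample /grid_rel /=.
  rewrite !inE !(inj_eq pinj) !xpair_eqE /= !andbF !andbT !orbF /=.
  by move: neq; rewrite xpair_eqE negb_and; case: (i == i'); case: (j == j').
Qed.

(** Degrees above [4m] yield [2m] disjoint pairs of equal degree, split into two families of [m].
    These pairs depend on the sample, so every injective [p] is assumed to have an alternating
    cell. *)
Lemma switchableP w :
  (0 < n)%N -> (0 < m)%N ->
  (forall v, ~~ (@deg (sample_graph w) v <= m.*2.*2)%N) ->
  (forall p, injective p -> ~~ [forall ij, ~~ grid_alternating p w ij]) ->
  switchable (sample_graph w).
Proof.
move=> n0 m0 hdeg hgrid.
have [|||s [sz us sP]] := @disjoint_equal_pairs (sample_graph w) (@deg
  (sample_graph w)) m.*2.*2 m.*2 _ _ _ => //.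
  by rewrite card_ord.
  by move=> v; rewrite deg_lt_card andbT ltnW // ltnNge.
case: s => [|x0 s'] in sz us sP; first by move: sz m0; case: (m).
set s := x0 :: s' in sz us sP.
(* Pair [i] of family [b] is pair number [b * m + i] of [s], at two consecutive positions. *)
pose idx (x : bool * 'I_m * bool) := ((x.1.1 * m + x.1.2).*2 + x.2)%N.
pose p : {ffun bool * 'I_m * bool -> 'I_n} := [ffun z => nth x0 s (idx z)].
have idx_lt z : (idx z < size s)%N.
  by case: z => [[[] i] []]; rewrite sz /idx /=; have := ltn_ord i; lia.
have pinj : injective p.
  move=> x y /eqP; rewrite !ffunE nth_uniq // => /eqP.
  case: x => [[bx ix] cx]; case: y => [[by_ iy] cy]; rewrite /idx /= => e.
  have := ltn_ord ix; have := ltn_ord iy => h1 h2.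
  have eb : bx = by_ by move: e; case: bx; case: by_ => //; case: cx; case: cy; lia.
  have ec : cx = cy by move: e; case: cx; case: cy => //=; lia.
  by have ei : ix = iy; [apply: val_inj; move: e; rewrite /= eb ec;
    lia | rewrite eb ec ei].
have := hgrid p pinj; rewrite negb_forall => /existsP[[i j]]; rewrite negbK => alt.
exists (p (false, i, false)), (p (true, j, false)), (p (true, j, true)), (p
  (false, i, true)).
have degp b i' : @deg (sample_graph w) (p (b, i', false)) = @deg (sample_graph w)
  (p (b, i', true)).
  rewrite !ffunE /idx /= addn0 addn1; apply: sP.
  by case: b => /=; have := ltn_ord i'; lia.
by split=> //; rewrite (inj_eq pinj) !xpair_eqE.
Qed.

End Grid.

(** The union bound over the [n ^ (4m)] choices of [p] is affordable because the grid has [m ^ 2]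
    cells. *)
Lemma pr_not_switchable m : (0 < n)%N -> (0 < m)%N ->
  pr (fun w => ~~ `[< switchable (sample_graph w) >])
  <= n%:R * ((n ^ m.*2.*2)%:R * 2^-1 ^+ (n - m.*2.*2.+1))
     + (n ^ m.*2.*2)%:R * (15 / 16) ^+ (m ^ 2).
Proof.
move=> n0 m0.
pose bad (p : {ffun bool * 'I_m * bool -> 'I_n}) w :=
  injectiveb p && [forall ij, ~~ grid_alternating p w ij].
apply: (@le_trans _ _ (pr (predU
   [pred w | [exists v, (@deg (sample_graph w) v <= m.*2.*2)%N]]
   [pred w | [exists p, bad p w]]))).
  apply: le_pr => w; apply: contraR;
    rewrite negb_or => /andP[/existsPn h1 /existsPn h2].
  apply/asboolP; apply: (switchableP n0 m0) => // p /injectiveP pinj.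
  by have := h2 p; rewrite /bad pinj.
apply: le_trans (prU _ _ _) _; apply: lerD.
  apply: le_trans (pr_exists _ _) _.
  apply: le_trans (ler_sum _ (fun v _ => pr_low_degree v m.*2.*2)) _.
  by rewrite sumr_const card_ord -[leLHS]mulr_natl.
apply: le_trans (pr_exists _ _) _.
have bound p : true -> pr (bad p) <= (15 / 16) ^+ (m ^ 2).
  move=> _; have [pinj|ninj] := boolP (injectiveb p).
    apply: le_trans (pr_no_grid_alternating (injectiveP _ pinj)).
    by apply: le_pr => w /andP[].
  rewrite pr_pred0; last by move=> w; rewrite /bad (negbTE ninj).
  by rewrite exprn_ge0 //; lra.
apply: le_trans (ler_sum _ bound) _.
rewrite sumr_const card_ffun !card_prod !card_bool !card_ord -[leLHS]mulr_natl.
by rewrite (_ : (2 * m * 2)%N = m.*2.*2) //; lia.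
Qed.

End Switchable.

(** * Asymptotics *)

Section Asymptotics.
Variable R : realType.

Lemma gnp_prob_half n (A : sgraph -> Prop) :
  @gnp_prob R n 2^-1 A = pr R (fun w : sample n => `[< A (sample_graph w) >]).
Proof.
rewrite /gnp_prob /pr (eq_bigr (fun=> 2^-1 ^+ #|vpair n|)).
  by rewrite sumr_const -[LHS]mulr_natl exprVn.
move=> w _; rewrite -prodr_const; apply: eq_bigr => e _; case: (w e) => //.
by lra.
Qed.

Lemma expr_le_half (a : R) (d e N : nat) :
  0 <= a <= 1 -> a ^+ d <= 2^-1 -> (d * e <= N)%N -> a ^+ N <= 2^-1 ^+ e.
Proof.
move=> /andP[a0 a1] ad deN; apply: le_trans (ler_wiXn2l a0 a1 deN) _.
by rewrite exprM; apply: lerXn2r; rewrite ?nnegrE ?exprn_ge0 ?invr_ge0.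
Qed.

(** Reduces each error estimate to an inequality between exponents of 2. *)
Lemma pow2_mul_le (x y : R) (a b k : nat) : 0 <= x -> 0 <= y ->
  x <= 2 ^+ a -> y <= 2^-1 ^+ b -> (a + k <= b)%N -> x * y <= 2^-1 ^+ k.
Proof.
move=> x0 y0 xa yb abk; apply: le_trans (ler_pM x0 y0 xa yb) _.
have -> : 2^-1 ^+ k = 2 ^+ a * 2^-1 ^+ (a + k) :> R.
  by rewrite exprD mulrA -exprMn mulfV ?pnatr_eq0 // expr1n mul1r.
rewrite ler_pM2l ?exprn_gt0 //; apply: ler_wiXn2l => //; lra.
Qed.

Lemma pr_good n k : (n < 2 ^ k)%N -> (1000 * k ^ 2 <= n)%N -> (0 < k)%N ->
  1 - 2^-1 ^+ k *+ 5 <= pr R (fun w : sample n =>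
     `[< counting_depth 2 (sample_graph w) = Some 4%N >]).
Proof.
move=> nk kn k0.
pose L := (4 * k)%N; pose j := (32 * k ^ 2)%N; pose m := (60 * k)%N.
have kk : (k <= k ^ 2)%N by rewrite expnS expn1 leq_pmulr.
have n0 : (0 < n)%N by nia.
have nX e : (n ^ e)%:R <= 2 ^+ (k * e) :> R.
  by rewrite exprM natrX lerXn2r ?nnegrE ?exprn_ge0 // -natrX ler_nat ltnW.
have n1X e : (n.+1 ^ e)%:R <= 2 ^+ (k * e) :> R.
  by rewrite exprM natrX lerXn2r ?nnegrE ?exprn_ge0 // -natrX ler_nat.
have h78 : 0 <= (7 / 8 : R) <= 1 by apply/andP; split; lra.
have h1516 : 0 <= (15 / 16 : R) <= 1 by apply/andP; split; lra.
(* Six factors 7/8, or eleven factors 15/16, are worth one factor 1/2. *)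
have e78 : (7 / 8 : R) ^+ 6 <= 2^-1 by lra.
have e1516 : (15 / 16 : R) ^+ 11 <= 2^-1 by lra.
have Lj : ((2 * L) ^ 2 <= j.*2.+1)%N by rewrite /L /j; nia.
have jn : (j.*2 <= n - 3)%N by rewrite /j; nia.
have sep : pr R (fun w : sample n => [exists uv : 'I_n * 'I_n,
    (uv.1 != uv.2) && @same_nbr_deg (sample_graph w) uv.1 uv.2])
    <= 2^-1 ^+ k *+ 3.
  apply: le_trans (pr_exists _ _) _.
  pose B : R := 2^-1 ^+ (n - 2)
     + n%:R * ((n.+1 ^ L)%:R * (7 / 8) ^+ (n - 3 - j.*2) + 2^-1 ^+ L).
  have B0 : 0 <= B.
    by rewrite !(addr_ge0, mulr_ge0, exprn_ge0) ?invr_ge0 //; lra.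
  have bound (uv : 'I_n * 'I_n) : true -> pr R (fun w : sample n =>
      (uv.1 != uv.2) && @same_nbr_deg (sample_graph w) uv.1 uv.2) <= B.
    move=> _; have [e|ne] := eqVneq uv.1 uv.2.
      by rewrite pr_pred0 // => w; rewrite e eqxx.
    apply: le_trans (pr_same_nbr_deg R ne Lj jn).
    by apply: le_pr => w /andP[].
  apply: le_trans (ler_sum _ bound) _.
  rewrite sumr_const card_prod !card_ord -[leLHS]mulr_natl.
  have -> : (n * n)%:R * B = (n ^ 2)%:R * 2^-1 ^+ (n - 2)
      + (n ^ 3 * n.+1 ^ L)%:R * (7 / 8) ^+ (n - 3 - j.*2) + (n ^ 3)%:R * 2^-1 ^+ L.
    rewrite /B; move: (_ ^+ (n - 2)) (_ ^+ (n - 3 - _)) (_ ^+ L) (n.+1 ^ L)%N.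
    by move=> X Y Z T; rewrite !natrM ?natrX; ring.
  rewrite [leRHS]mulrSr [in leRHS]mulr2n; apply: lerD; first apply: lerD.
  - apply: pow2_mul_le (nX 2) _ _; rewrite ?exprn_ge0 ?invr_ge0 //; nia.
  - have nn : (n ^ 3 * n.+1 ^ L)%:R <= 2 ^+ (k * 3 + k * L) :> R.
      by rewrite natrM exprD ler_pM.
    apply: pow2_mul_le nn (expr_le_half (e := k * 4 + k * L) h78 e78 _) _.
    + by [].
    + by rewrite exprn_ge0 //; lra.
    + rewrite /L /j; nia.
    + nia.
  - apply: pow2_mul_le (nX 3) _ _; rewrite ?exprn_ge0 ?invr_ge0 // /L; nia.
have sw : pr R (fun w : sample n => ~~ `[< switchable (sample_graph w) >])
    <= 2^-1 ^+ k *+ 2.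
  have m0 : (0 < m)%N by rewrite /m; nia.
  apply: le_trans (pr_not_switchable R n0 m0) _.
  rewrite mulr2n; apply: lerD.
    rewrite mulrA -natrM -expnS.
    apply: pow2_mul_le (nX _) (lexx _) _; rewrite ?exprn_ge0 ?invr_ge0 // /m; nia.
  apply: pow2_mul_le (nX _) (expr_le_half (e := k * (m.*2.*2).+1) h1516 e1516 _) _.
  - by [].
  - by rewrite exprn_ge0 //; lra.
  - rewrite /m; nia.
  - nia.
rewrite lerBlDr -lerBlDl -prC.
apply: le_trans (_ : _ <= 2^-1 ^+ k *+ 3 + 2^-1 ^+ k *+ 2) _;
  last by rewrite -mulrnDr.
apply: le_trans (lerD sep sw); apply: le_trans (prU _ _ _); apply: le_pr => w /=.
apply: contraR; rewrite negb_or negb_exists negbK => /andP[/forallP h /asboolP sww].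
apply/asboolP; apply: counting_depth_eq4 => // x y xy.
by apply/eqP; have := h (x, y); rewrite /= xy andbT negbK.
Qed.

(** Induction on the logarithm [l] from 19, where [1000 * 20 ^ 2 <= 2 ^ 19]; afterwards
    [(l + 1) ^ 2] less than doubles at each step. *)
Lemma large_trunc_log n : (2 ^ 19 <= n)%N ->
  (1000 * (trunc_log 2 n).+1 ^ 2 <= n)%N.
Proof.
move=> n19; have n0 : (0 < n)%N by apply: leq_trans n19; rewrite expn_gt0.
have /andP[ln _] := trunc_log_bounds (isT : (1 < 2)%N) n0.
have := trunc_log_max (isT : (1 < 2)%N) n19.
move: (trunc_log 2 n) ln => l ln l19; apply: leq_trans ln.
rewrite -(subnKC l19); elim: (l - 19)%N => [|i IH]; first by rewrite addn0; lia.
have sq : ((19 + i).+2 ^ 2 <= 2 * (19 + i).+1 ^ 2)%N by rewrite -!mulnn; nia.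
by rewrite addnS [X in (_ <= X)%N]expnS; move: IH sq; lia.
Qed.

End Asymptotics.

Local Open Scope classical_set_scope.

Theorem theorem6p3 (R : realType) :
  (fun n : nat =>
     @gnp_prob R n (2^-1) (fun G : sgraph => counting_depth 2 G = Some 4%N))
    @ \oo --> (1 : R).
Proof.
(* With [k] one more than the integer logarithm, [n < 2 ^ k], so each of the five error terms
   [2 ^- k] is at most [1 / (n + 1)]. *)
apply: (@squeeze_cvgr _ _ _ _ (fun n => 1 - harmonic n *+ 5) (fun=> 1)).
- near=> n; rewrite gnp_prob_half pr_le1 andbT.
  have n19 : (2 ^ 19 <= n)%N by near: n; exact: nbhs_infty_ge.
  have n0 : (0 < n)%N by apply: leq_trans n19; rewrite expn_gt0.
  have /andP[_ nk] := trunc_log_bounds (isT : (1 < 2)%N) n0.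
  apply: le_trans (pr_good R nk (large_trunc_log n19) _) => //.
  rewrite lerB // lerMn2r //= /harmonic exprVn lef_pV2 ?posrE ?exprn_gt0 //.
  by rewrite -natrX ler_nat.
- rewrite -[X in _ --> X]subr0 -(mul0rn _ 5); apply: cvgB; first exact: cvg_cst.
  by apply: cvgMn; exact: cvg_harmonic.
- exact: cvg_cst.
Unshelve. all: by end_near.
Qed.
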